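(* Let $D$ be an almost Dedekind domain with finite residue fields and quotient field $K$, with the principal ideal domain $D_0\subseteq D$ described in the context. For each nonzero prime $P$ of $D$, let $I_P$ be an index set and let $\{V_{P,i}\mid i\in I_P\}$ be a collection of valuation overrings of $D[X]$ (valuation rings of $K(X)$ containing $D[X]$) such that, for each $i\in I_P$, the associated valuation $v_{P,i}$ of $K(X)$ extends $v_P$; let $M_{P,i}$ be the maximal ideal of $V_{P,i}$. Assume that for each nonzero prime element $p$ of $D_0$: (i) there exists $e_p\ge 1$ such that for all primes $P$ of $D$ above $p$ and all $i\in I_P$, $M_{P,i}^{e_p}\subseteq pV_{P,i}$; and (ii) there exists $f_p\ge 1$ such that for all primes $P$ of $D$ above $p$ and all $i\in I_P$, $[(V_{P,i}/M_{P,i}):(D_0/pD_0)]\le f_p$. Then the ring $$\mathscr{D}:=\bigcap_{P\in\mathrm{Max}(D)}\Big(\bigcap_{i\in I_P}V_{P,i}\Big)\cap K[X]$$ is a Prüfer domain.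
   Context: An integral domain $D$, not a field, is an almost Dedekind domain if $D_M$ is a discrete valuation ring for each maximal ideal $M$ of $D$. $\mathrm{Max}(D)$ is the set of maximal ideals of $D$. Such a $D$ with finite residue fields contains a principal ideal domain $D_0$: if $\mathrm{char}(K)=0$, $D_0\cong\mathbb{Z}$; if $\mathrm{char}(K)>0$, $D_0\cong F[t]$, the univariate polynomial ring over the prime field $F$ with $\mathrm{char}(K)$ elements. A prime $P$ of $D$ is above a nonzero prime element $p$ of $D_0$ if $P\cap D_0=pD_0$. For each nonzero prime $P$ of $D$, $v_P$ is the normalized $P$-adic valuation on $K$. *)

(* Defs.v *)
From HB Require Import structures.
From mathcomp Require Import all_boot all_order all_algebra.
From mathcomp Require Import boolp classical_sets functions cardinality.

Set Implicit Arguments.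
Unset Strict Implicit.
Unset Printing Implicit Defensive.

Import Order.TTheory GRing.Theory Num.Theory.
Local Open Scope classical_set_scope.
Local Open Scope ring_scope.

(* Integral domains are handled as subrings (Prop-valued sets) of an ambient
   field, and their ideals as subsets of that field. *)

Section SubringsOfAField.
Variable L : fieldType.
Implicit Types R I J P M V : set L.

Definition subring R : Prop :=
  [/\ R 1, forall x y, R x -> R y -> R (x - y)
    & forall x y, R x -> R y -> R (x * y)].

Definition quotient_field R : set L :=
  [set x | exists a b, [/\ R a, R b, b != 0 & x = a / b]].

Definition not_a_field R : Prop := exists2 x, R x & x != 0 /\ ~ R x^-1.

Definition ideal R I : Prop :=
  [/\ I `<=` R, I 0, forall x y, I x -> I y -> I (x + y)
    & forall r x, R r -> I x -> I (r * x)].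

Definition prime_ideal R P : Prop :=
  [/\ ideal R P, ~ P 1
    & forall x y, R x -> R y -> P (x * y) -> P x \/ P y].

Definition nonzero_prime_ideal R P : Prop :=
  prime_ideal R P /\ P <> [set 0].

Definition maximal_ideal R M : Prop :=
  [/\ ideal R M, ~ M 1
    & forall I, ideal R I -> ~ I 1 -> M `<=` I -> I = M].

Definition Max R : set (set L) := [set M | maximal_ideal R M].

Definition principal_ideal R (a : L) : set L := [set a * r | r in R].

Definition prime_element R (p : L) : Prop :=
  [/\ R p, p != 0, ~ R p^-1
    & forall a b, R a -> R b -> principal_ideal R p (a * b) ->
        principal_ideal R p a \/ principal_ideal R p b].

Definition localization R P : set L :=
  [set x | exists a b, [/\ R a, R b, ~ P b & x = a / b]].

Definition residue_ring R I : set (set L) :=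
  [set [set y | I (y - x)] | x in R].

Definition finite_residue_fields R : Prop :=
  forall M, Max R M -> finite_set (residue_ring R M).

(* Finite sums of products; also used for fractional ideals. *)
Definition ideal_mul I J : set L :=
  [set x | exists2 s : seq (L * L),
     (forall u, u \in s -> I u.1 /\ J u.2) & x = \sum_(u <- s) u.1 * u.2].

Definition ideal_exp R I (n : nat) : set L := iter n (ideal_mul I) R.

Definition fg_ideal R I : Prop :=
  exists (n : nat) (g : 'I_n -> L), (forall j, R (g j)) /\
    I = [set x | exists2 c : 'I_n -> L,
           (forall j, R (c j)) & x = \sum_j c j * g j].

Definition ideal_inv R I : set L :=
  [set x | quotient_field R x /\ forall y, I y -> R (x * y)].

Definition invertible_ideal R I : Prop := ideal_mul I (ideal_inv R I) = R.

Definition Pruefer_domain R : Prop :=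
  subring R /\
  forall I, fg_ideal R I -> I <> [set 0] -> invertible_ideal R I.

(* [(V/M) : (R0/P0)] = n: e is a family of elements of V whose classes modulo M
   form a basis of V/M over R0/P0, with scalars lifted to R0. *)
Definition residue_degree R0 P0 V M (n : nat) : Prop :=
  exists e : 'I_n -> L,
  [/\ forall j, V (e j),
      forall y, V y -> exists2 c : 'I_n -> L,
        (forall j, R0 (c j)) & M (y - \sum_j c j * e j)
    & forall c : 'I_n -> L, (forall j, R0 (c j)) ->
        M (\sum_j c j * e j) -> forall j, P0 (c j)].

Definition valuation_ring V : Prop :=
  subring V /\ forall x, x != 0 -> V x \/ V x^-1.

Definition totally_ordered_group (G : porderZmodType) : Prop :=
  (forall g h : G, g <= h \/ h <= g) /\
  (forall g h k : G, g <= h -> g + k <= h + k).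

(* A valuation is a map on nonzero elements; its value at 0 is irrelevant
   (conventionally infinite). *)
Definition valuation (G : porderZmodType) (v : L -> G) : Prop :=
  [/\ totally_ordered_group G,
      forall x y, x != 0 -> y != 0 -> v (x * y) = v x + v y
    & forall x y, x != 0 -> y != 0 -> x + y != 0 ->
        Order.min (v x) (v y) <= v (x + y)].

Definition ring_of_valuation (G : porderZmodType) (v : L -> G) : set L :=
  [set x | x = 0 \/ 0 <= v x].

Definition normalized_discrete_valuation (v : L -> int) : Prop :=
  valuation v /\ forall n : int, exists2 x, x != 0 & v x = n.

Definition DVR R : Prop :=
  exists2 v : L -> int,
    normalized_discrete_valuation v & R = ring_of_valuation v.

Definition almost_Dedekind R : Prop :=
  [/\ subring R, not_a_field R
    & forall M, Max R M -> DVR (localization R M)].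

Definition padic_valuation R P (v : L -> int) : Prop :=
  normalized_discrete_valuation v /\ ring_of_valuation v = localization R P.

(* D0 is a copy of the integers in characteristic 0, and a copy of the
   univariate polynomial ring over the prime field in characteristic q > 0. *)
Definition base_PID (D0 : set L) : Prop :=
  ([pchar L] =i pred0 ->
     exists2 f : {rmorphism int -> L}, injective f & D0 = range f) /\
  (forall q : nat, q \in [pchar L] ->
     exists2 f : {rmorphism {poly 'F_q} -> L}, injective f & D0 = range f).

End SubringsOfAField.

Section RationalFunctions.
Variable K : fieldType.

Definition ratfun : fieldType := {fraction {poly K}}.

Definition ratC (c : K) : ratfun := tofrac c%:P.

Definition polys_over (D : set K) : set ratfun :=
  [set x | exists2 f : {poly K}, (forall j, D f`_j) & x = tofrac f].

Definition valuation_overring (D : set K) (V : set ratfun) : Prop :=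
  valuation_ring V /\ polys_over D `<=` V.

(* The valuation associated with V is only determined up to isomorphism of
   value groups, hence the embedding of the value group of vK. *)
Definition associated_valuation_extends (V : set ratfun) (vK : K -> int) :=
  exists (G : porderZmodType) (v : ratfun -> G) (iota : {additive int -> G}),
  [/\ valuation v, V = ring_of_valuation v,
      {mono iota : m n / m <= n}
    & forall c : K, c != 0 -> v (ratC c) = iota (vK c)].

End RationalFunctions.

(* Main.v *)
(** Let [R] be the intersection and [g_1, ..., g_n] generators of a nonzero
    finitely generated ideal. The sums [sum_j z_j g_j] with all [z_j g_i] in [R]
    form an ideal [T] of [R], and the claim is that [1] lies in [T]. Bezout in
    [K[X]] and clearing denominators put a nonzero element [d] of [D0] into [T]
    (every element of [K] has a denominator in [D0], because the nonzero primes
    of [D] are maximal with finite residue field while [D0] is infinite). It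
    remains to cancel the prime factors [p] of [d] one at a time.

    The bounds on ramification and residue degree give one exponent [t] such
    that, in every [V] above [p], each [x ^ t] is a power of [p] times a unit,
    at least modulo high powers of [p], and units satisfy [w ^ t = 1] modulo [p].
    Hence [t]-th powers of polynomials behave like indicator functions on the set
    of rings [V] above [p]. Running through the values [s = 0, 1, ...] and the
    generators [g_k], one gathers polynomials [z_j] for which [sum_j z_j g_j = 1]
    modulo [p] in all these rings simultaneously; a denominator prime to [p]
    makes them global, and Bezout in [D0] cancels [p]. *)

Require Import Defs.
From HB Require Import structures.
From mathcomp Require Import all_boot all_order all_algebra.
From mathcomp Require Import boolp classical_sets functions cardinality.
From mathcomp Require Import ring.

Set Implicit Arguments.
Unset Strict Implicit.
Unset Printing Implicit Defensive.

Import Order.TTheory GRing.Theory Num.Theory.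
Local Open Scope classical_set_scope.
Local Open Scope ring_scope.

(** * Subrings and Euclidean subrings *)

Section SubringTheory.
Variables (L : fieldType) (R : set L).
Hypothesis Rring : subring R.

Lemma subring1 : R 1. Proof. by case: Rring. Qed.
Lemma subringB x y : R x -> R y -> R (x - y). Proof. by case: Rring => _ + _; apply. Qed.
Lemma subringM x y : R x -> R y -> R (x * y). Proof. by case: Rring => _ _; apply. Qed.
Lemma subring0 : R 0.
Proof. by rewrite -(subrr 1); apply: subringB; apply: subring1. Qed.
Lemma subringN x : R x -> R (- x).
Proof. by rewrite -sub0r; apply: subringB subring0. Qed.
Lemma subringD x y : R x -> R y -> R (x + y).
Proof. by move=> Rx Ry; rewrite -[y]opprK; apply: subringB => //; apply: subringN. Qed.
Lemma subringX x n : R x -> R (x ^+ n).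
Proof.
by move=> Rx; elim: n => [|n IHn]; rewrite ?exprS; [apply: subring1 | apply: subringM].
Qed.
Lemma subring_sum (J : Type) (r : seq J) (F : J -> L) :
  (forall j, R (F j)) -> R (\sum_(j <- r) F j).
Proof. by move=> RF; elim/big_ind: _ => //; [apply: subring0 | apply: subringD]. Qed.
Lemma subring_nat n : R n%:R.
Proof.
elim: n => [|n IHn]; first exact: subring0.
by rewrite -addn1 natrD; apply: subringD => //; apply: subring1.
Qed.

(** Divisibility by [c] in [R] is written [R (x / c)], with the quotient taken in [L]. Congruence to
    1 modulo [c] passes to powers because [x - 1] divides [x ^ n - 1]. *)
Lemma subring_sub1X x c n :
  R x -> R ((x - 1) / c) -> R ((x ^+ n - 1) / c).
Proof.
move=> Rx Rxc; rewrite subrX1 mulrAC; apply: subringM => //.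
by apply: subring_sum => i; apply: subringX.
Qed.

End SubringTheory.

Section EuclideanSubrings.
Variable L : fieldType.
Implicit Types R : set L.

(** Covers the integers and [F[t]] at once. Strict growth of [N] under multiplication by nonunits
    lets inductions on [N] remove prime factors. *)
Record euclidean_subring R (N : L -> nat) : Prop := EuclideanSubring {
  euclidean_ring : subring R;
  euclidean_div : forall a b, R a -> R b -> b != 0 ->
    exists2 q, R q & a = q * b \/ (N (a - q * b)%R < N b)%N;
  euclidean_norm : forall a b, R a -> R b -> a != 0 -> b != 0 ->
    ~ R b^-1 -> (N a < N (a * b)%R)%N }.

Variables (R : set L) (N : L -> nat).
Hypothesis RN : euclidean_subring R N.
Let Rr := euclidean_ring RN.

Lemma principal_idealP (a x : L) : a != 0 -> principal_ideal R a x <-> R (x / a).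
Proof.
move=> a0; split=> [[r Rr' <-]|Rx]; first by rewrite mulrC mulKf.
by exists (x / a) => //; rewrite mulrC divfK.
Qed.

(** A nonzero combination of least norm divides all others: a nonzero remainder would be a
    combination of smaller norm. *)
Lemma euclidean_bezout x y : R x -> R y -> y != 0 ->
  exists g u w, [/\ R u, R w, g = u * x + w * y, g != 0 & R (x / g) /\ R (y / g)].
Proof.
move=> Rx Ry y0.
pose C n := `[<exists u w, [/\ R u, R w, u * x + w * y != 0 & N (u * x + w * y) = n]>].
have exC : exists n, C n.
  exists (N y); apply/asboolP; exists 0, 1; rewrite mul0r mul1r add0r.
  by split=> //; [apply: subring0 | apply: subring1].
case: (ex_minnP exC) => n /asboolP [u [w [Ru Rw g0 Ng]]] min_n.
set g := u * x + w * y in g0 Ng.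
have Rg : R g by apply: subringD => //; apply: subringM.
have dvd a b : R a -> R b -> R ((a * x + b * y) / g).
  move=> Ra Rb; set c := a * x + b * y.
  have Rc : R c by apply: subringD => //; apply: subringM.
  have [q Rq [->|lt]] := euclidean_div RN Rc Rg g0; first by rewrite mulfK.
  have [->|nz] := eqVneq c (q * g); first by rewrite mulfK.
  have : C (N (c - q * g)).
    apply/asboolP; exists (a - q * u), (b - q * w).
    have -> : (a - q * u) * x + (b - q * w) * y = c - q * g by rewrite /c /g; ring.
    rewrite subr_eq0; split=> //; apply: subringB => //; exact: subringM.
  by move/min_n; rewrite -Ng leqNgt lt.
exists g, u, w; split=> //; split.
  by have := dvd 1 0 (subring1 Rr) (subring0 Rr); rewrite mul1r mul0r addr0.
by have := dvd 0 1 (subring0 Rr) (subring1 Rr); rewrite mul1r mul0r add0r.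
Qed.

(** The gcd [g] of [x] and [p] is a unit: in [p = g * (p / g)] the prime [p] divides either [g],
    hence [x], or [p / g], which makes [g] invertible. *)
Lemma prime_element_bezout p x : prime_element R p -> R x -> ~ R (x / p) ->
  exists u w, [/\ R u, R w & u * x + w * p = 1].
Proof.
move=> [Rp p0 pnu pp] Rx npx.
have [g [u [w [Ru Rw gE g0 [xg pg]]]]] := euclidean_bezout Rx Rp p0.
have Rg : R g by rewrite gE; apply: subringD => //; apply: subringM.
have Rgi : R g^-1.
  case: (pp g (p / g)) => //.
  - apply/principal_idealP => //; have -> : g * (p / g) / p = 1 by field; rewrite p0 g0.
    exact: subring1.
  - move/principal_idealP => /(_ p0) gp; case: npx.
    have -> : x / p = (x / g) * (g / p) by field; rewrite p0 g0.
    exact: subringM.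
  - move/principal_idealP => /(_ p0); have -> // : p / g / p = g^-1 by field; rewrite p0 g0.
exists (u / g), (w / g); split; try exact: subringM.
have -> : u / g * x + w / g * p = (u * x + w * p) / g by ring.
by rewrite -gE divff.
Qed.

(** A nonunit divisor [p] of [d] of least norm is prime: let [p] divide [a * b] and let [g] be the
    gcd of [a] and [p]. If [g] is a unit, [p] divides [b]; otherwise [g] is a nonunit divisor of
    [d], and minimality makes [p] divide [g], hence [a]. *)
Lemma exists_prime_divisor d : R d -> d != 0 -> ~ R d^-1 ->
  exists2 p, prime_element R p & R (d / p).
Proof.
move=> Rd d0 dnu.
pose C n := `[<exists p, [/\ R p, p != 0, ~ R p^-1, R (d / p) & N p = n]>].
have exC : exists n, C n.
  by exists (N d); apply/asboolP; exists d; split=> //; rewrite divff //; apply: subring1.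
case: (ex_minnP exC) => n /asboolP [p [Rp p0 pnu pd Np]] min_n.
exists p => //; split=> // a b Ra Rb /principal_idealP => /(_ p0) pab.
have [g [u [w [Ru Rw gE g0 [ag pg]]]]] := euclidean_bezout Ra Rp p0.
have Rg : R g by rewrite gE; apply: subringD => //; apply: subringM.
have [Rgi|gnu] := pselect (R g^-1).
  right; apply/principal_idealP => //.
  have -> : b / p = g^-1 * (u * (a * b / p) + w * b).
    have -> : u * (a * b / p) + w * b = (u * a + w * p) * (b / p) by field.
    by rewrite -gE mulKf.
  apply: subringM => //; apply: subringD => //; exact: subringM.
left; apply/principal_idealP => //.
have pgi : R (g / p).
  apply: contrapT => npg.
  have lt : (N g < N p)%N.
    rewrite -[p](divfK g0) mulrC; apply: (euclidean_norm RN) => //; first by rewrite mulf_neq0 ?invr_eq0.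
    by rewrite invf_div.
  have : C (N g).
    apply/asboolP; exists g; split=> //.
    have -> : d / g = (d / p) * (p / g) by field; rewrite p0 g0.
    exact: subringM.
  by move/min_n; rewrite -Np leqNgt lt.
have -> : a / p = (a / g) * (g / p) by field; rewrite p0 g0.
exact: subringM.
Qed.

(** [Q x] will say that the constant [x] lies in the inverse span of given generators. Each division
    by a prime lowers the norm, so the process ends at a unit. *)
Lemma prime_cancel_unit (Q : L -> Prop) :
  (forall p d, prime_element R p -> R d -> d != 0 -> Q (p * d) -> Q d) ->
  forall d, R d -> d != 0 -> Q d -> exists2 u, R u & R u^-1 /\ (u != 0 /\ Q u).
Proof.
move=> HQ d; have [n] := ubnP (N d); elim: n d => // n IHn d Nd Rd d0 Qd.
have [|dnu] := pselect (R d^-1); first by exists d.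
have [p pp pd] := exists_prime_divisor Rd d0 dnu.
have [Rp p0 pnu _] := pp.
have dp0 : d / p != 0 by rewrite mulf_neq0 ?invr_eq0.
apply: (IHn (d / p)) => //.
  move: Nd; rewrite ltnS; apply: leq_trans.
  by rewrite -{2}[d](divfK p0); apply: (euclidean_norm RN).
by apply: (HQ p) => //; rewrite mulrC divfK.
Qed.

Lemma prime_factor_out p d : prime_element R p -> R d -> d != 0 ->
  exists c d', [/\ R d', ~ R (d' / p), d' != 0 & d = p ^+ c * d'].
Proof.
move=> pp; have [n] := ubnP (N d); elim: n d => // n IHn d Nd Rd d0.
have [Rp p0 pnu _] := pp.
have [pd|npd] := pselect (R (d / p)); last by exists 0%N, d; rewrite mul1r.
have dp0 : d / p != 0 by rewrite mulf_neq0 ?invr_eq0.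
have [|c [d' [Rd' nd' d'0 E]]] := IHn (d / p) _ pd dp0.
  move: Nd; rewrite ltnS; apply: leq_trans.
  by rewrite -{2}[d](divfK p0); apply: (euclidean_norm RN).
by exists c.+1, d'; split=> //; rewrite exprS -mulrA -E mulrC divfK.
Qed.

End EuclideanSubrings.
Arguments principal_idealP {L R a x}.

Lemma range_subring (L : fieldType) (A : nzRingType) (f : {rmorphism A -> L}) :
  subring (range f).
Proof.
split; first by exists 1; rewrite ?rmorph1.
  by move=> _ _ [a _ <-] [b _ <-]; exists (a - b); rewrite ?rmorphB.
by move=> _ _ [a _ <-] [b _ <-]; exists (a * b); rewrite ?rmorphM.
Qed.

Section RangeEuclidean.
Variables (L : fieldType) (A : idomainType) (f : {rmorphism A -> L}) (N : A -> nat).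
Hypothesis f_inj : injective f.
Hypothesis N_div : forall a b, b != 0 ->
  exists q, a = q * b \/ (N (a - q * b)%R < N b)%N.
Hypothesis N_mul : forall a b, a != 0 -> b != 0 -> b \isn't a GRing.unit ->
  (N a < N (a * b)%R)%N.

Lemma range_euclidean : exists N', euclidean_subring (range f) N'.
Proof.
(* [g] inverts [f] on its range and is 0 elsewhere, so the norm is defined on all of [L]. *)
pose g x := xget 0 [set a | f a = x].
have gK : cancel f g.
  by move=> a; apply: f_inj; apply: (@xgetPex _ 0 [set b | f b = f a]); exists a.
exists (N \o g); split; first exact: range_subring.
- move=> _ _ [a _ <-] [b _ <-] b0.
  have b0' : b != 0 by apply: contra_neq b0 => ->; rewrite rmorph0.
  have [q Hq] := N_div a b0'; exists (f q); first by exists q.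
  case: Hq => [->|lt]; [left; exact: rmorphM | right].
  by rewrite /= -rmorphM -rmorphB !gK.
- move=> _ _ [a _ <-] [b _ <-] a0 b0 nu /=.
  rewrite -rmorphM !gK; apply: N_mul.
  + by apply: contra_neq a0 => ->; rewrite rmorph0.
  + by apply: contra_neq b0 => ->; rewrite rmorph0.
  + apply/negP => ub; apply: nu; exists b^-1 => //.
    by apply: (mulfI b0); rewrite -rmorphM mulrV // rmorph1 divff.
Qed.

End RangeEuclidean.

Lemma range_infinite (T U : Type) (f : T -> U) (g : nat -> T) :
  injective f -> injective g -> infinite_set (range f).
Proof.
move=> f_inj g_inj fin; apply: infinite_nat.
have -> : [set: nat] = (f \o g) @^-1` range f.
  by apply/seteqP; split=> // n _; exists (g n).
by apply: finite_preimage => // m n _ _ /f_inj /g_inj.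
Qed.

(** Infinitude will force every maximal ideal of [D] to contain a nonzero element of [D0]. *)
Lemma base_PID_euclidean (L : fieldType) (D0 : set L) : base_PID D0 ->
  infinite_set D0 /\ exists N, euclidean_subring D0 N.
Proof.
move=> [H0 Hq].
have [[q qL]|noq] := pselect (exists q, q \in [pchar L]); last first.
  have [|f f_inj ->] := H0.
    by move=> q; apply/negbTE/negP => qL; apply: noq; exists q.
  split; first by apply: (range_infinite (g := Posz)) => // m n [].
  apply: (range_euclidean (N := absz)) => //.
  - move=> a b b0; exists (a %/ b)%Z; right.
    rewrite {1}(divz_eq a b) addrAC subrr add0r.
    by rewrite -ltz_nat gez0_abs ?modz_ge0 // abszE ltz_mod.
  - move=> a b a0 b0 nu; rewrite abszM ltn_Pmulr ?absz_gt0 //.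
    rewrite ltn_neqAle absz_gt0 b0 andbT eq_sym; apply: contra nu.
    by case: b {b0} => [[|[|]]|[|]].
have [f f_inj ->] := Hq q qL; split.
  apply: (range_infinite (g := fun n => 'X^n : {poly 'F_q})) => // m n.
  by move/(congr1 (fun p : {poly 'F_q} => size p)); rewrite !size_polyXn => -[].
apply: (range_euclidean (N := fun p : {poly 'F_q} => size p)) => //.
- move=> a b b0; exists (a %/ b); right.
  by rewrite {1}(divp_eq a b) addrAC subrr add0r ltn_modp.
- move=> a b a0 b0 nu; rewrite size_mul // -subn1 -addnBA ?size_poly_gt0 //.
  rewrite -[X in (X < _)%N]addn0 ltn_add2l subn_gt0.
  rewrite ltn_neqAle size_poly_gt0 b0 andbT eq_sym.
  by apply: contra nu; rewrite poly_unitE => /[dup] /size_poly1P [c c0 ->] ->; rewrite coefC unitfE.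
Qed.

(** * Valuation rings with bounded ramification and residue degree *)

Section ValuationRings.
Variables (L : fieldType) (V : set L).
Hypothesis V_val : valuation_ring V.
Let Vr : subring V := V_val.1.

Lemma valuation_ring_inv x : ~ V x -> V x^-1.
Proof.
have [-> []|x0 nVx] := eqVneq x 0; first exact: subring0.
by case: (V_val.2 x x0).
Qed.

(** A case of integral closedness: if [x] is not in [V], then [x^-1] is, and so is the product of
    [x ^ n] and [x^-1 ^ (n - 1)], which is [x]. *)
Lemma valuation_ring_root x n : (0 < n)%N -> V (x ^+ n) -> V x.
Proof.
case: n => // n _ Vxn; apply: contrapT => nVx; apply: (nVx).
have [x0|x0] := eqVneq x 0; first by rewrite x0; apply: subring0.
have -> : x = x ^+ n.+1 * x^-1 ^+ n by rewrite exprVn exprS mulfK // expf_neq0.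
by apply: subringM => //; apply: subringX => //; apply: valuation_ring_inv.
Qed.

Variable M : set L.
Hypothesis M_max : maximal_ideal V M.

(** Nonunits are closed under addition because [y / z] or [z / y] lies in [V]; so they form a proper
    ideal, which contains [M] and hence equals it. Zero is listed apart since [0^-1 = 0] lies in
    [V]. *)
Lemma maximal_idealE x : M x <-> V x /\ (x = 0 \/ ~ V x^-1).
Proof.
have [[MV M0 MD MM] M1 Mmax] := M_max.
pose N := [set x | V x /\ (x = 0 \/ ~ V x^-1)].
have NV y : N y -> V y by case.
have N_absorb r y : V r -> N y -> N (r * y).
  move=> Vr' [Vy ny]; split; first exact: subringM.
  have [->|r0] := eqVneq r 0; first by left; rewrite mul0r.
  case: ny => [->|ny]; first by left; rewrite mulr0.
  right => Vry; apply: ny.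
  have -> : y^-1 = r * (r * y)^-1 by rewrite invfM mulVKf.
  exact: subringM.
suff -> : M = N by [].
apply/esym/Mmax.
- split=> //; first by split; [exact: subring0 | left].
  move=> y z Ny Nz.
  have [->|y0] := eqVneq y 0; first by rewrite add0r.
  have [->|z0] := eqVneq z 0; first by rewrite addr0.
  have [Vyz|/valuation_ring_inv] := pselect (V (y / z)).
    have -> : y + z = (y / z + 1) * z by field.
    by apply: N_absorb => //; apply: subringD => //; apply: subring1.
  rewrite invf_div => Vzy.
  have -> : y + z = (z / y + 1) * y by field.
  by apply: N_absorb => //; apply: subringD => //; apply: subring1.
- by case=> _ [/eqP|]; rewrite ?oner_eq0 // invr1; case; apply: subring1.
- move=> y My; split; first exact: MV.
  have [->|y0] := eqVneq y 0; [by left | right=> Vyi; apply: M1].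
  by rewrite -(mulVf y0); apply: MM.
Qed.

Lemma maximal_ideal_unit x : V x -> ~ M x -> V x^-1.
Proof.
by move=> Vx nMx; apply: contrapT => nVi; apply/nMx/maximal_idealE; split=> //; right.
Qed.

Variables (p : L) (e : nat).
Hypotheses (p0 : p != 0) (Mp : M p).
Hypothesis M_exp : ideal_exp V M e `<=` principal_ideal V p.

Let Vp : V p. Proof. by have [] := (maximal_idealE p).1 Mp. Qed.
Let nVpi : ~ V p^-1.
Proof. by have [_ [/eqP|//]] := (maximal_idealE p).1 Mp; rewrite (negbTE p0). Qed.

(* If [M ^ k] is the first power contained in [pV] and [a] lies in
   [M ^ k.-1] but not in [pV], then [p / a] generates [M]. *)
Lemma bounded_ramification_uniformizer : exists2 pi, M pi & pi != 0 /\
  forall x, M x -> V (x / pi).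
Proof.
pose C k := `[<ideal_exp V M k `<=` principal_ideal V p>].
have exC : exists k, C k by exists e; apply/asboolP.
case: (ex_minnP exC) => -[|k] /asboolP Ck min_k.
  case: nVpi; have /(principal_idealP p0) : principal_ideal V p 1.
    by apply: Ck; apply: subring1.
  by rewrite mul1r.
have [a ka npa] : exists2 a, ideal_exp V M k a & ~ V (a / p).
  apply: contrapT => H.
  have : C k.
    apply/asboolP => a ka; apply/(principal_idealP p0).
    by apply: contrapT => na; apply: H; exists a.
  by move/min_k; rewrite ltnn.
have a0 : a != 0 by apply: contra_notN npa => /eqP ->; rewrite mul0r; apply: subring0.
exists (p / a).
  apply/maximal_idealE; split; first by rewrite -invf_div; apply: valuation_ring_inv.
  by right; rewrite invf_div.
split=> [|x Mx]; first by rewrite mulf_neq0 ?invr_eq0.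
rewrite invf_div mulrA; apply/(principal_idealP p0)/Ck.
exists [:: (x, a)]; last by rewrite big_seq1.
by move=> u; rewrite inE => /eqP ->.
Qed.

Section Uniformizer.
Variable pi : L.
Hypotheses (Mpi : M pi) (pi0 : pi != 0) (piP : forall x, M x -> V (x / pi)).

(** [V] need not have rank one, so a nonzero element may be divisible by every power of [pi]; the
    division is therefore stopped after [n] steps. *)
Lemma uniformizer_factor x n : V x -> V (x / pi ^+ n) \/
  exists j u, [/\ (j < n)%N, V u, V u^-1, u != 0 & x = pi ^+ j * u].
Proof.
elim: n x => [|n IHn] x Vx; first by left; rewrite divr1.
have [Mx|nMx] := pselect (M x); last first.
  right; exists 0%N, x; split; rewrite ?mul1r //; first exact: maximal_ideal_unit.
  by apply: contra_notN nMx => /eqP ->; apply/maximal_idealE; split; [apply: subring0|left].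
have [|[j [u [lt Vu Vui u0 E]]]] := IHn _ (piP Mx).
  by left; rewrite exprS invfM mulrA.
by right; exists j.+1, u; split=> //; rewrite exprS -mulrA -E mulrC divfK.
Qed.

(** [pi ^ e] lies in [M ^ e], hence in [pV]; so [p] has at most [e] factors [pi]. *)
Lemma ramification_index : exists k u,
  [/\ (0 < k <= e)%N, V u, V u^-1, u != 0 & p = pi ^+ k * u].
Proof.
have Vpi_e : V (pi ^+ e / p).
  apply/(principal_idealP p0)/M_exp.
  elim: e => [|n IHn]; first exact: subring1.
  exists [:: (pi, pi ^+ n)]; last by rewrite big_seq1 exprS.
  by move=> u; rewrite inE => /eqP ->.
have [Vpe|[k [u [ke Vu Vui u0 E]]]] := uniformizer_factor e Vp.
  exists e, (p / pi ^+ e); split=> //; last by rewrite mulrC divfK // expf_neq0.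
  - rewrite leqnn andbT lt0n; apply/eqP => e0; apply: nVpi.
    by move: Vpi_e; rewrite e0 mul1r.
  - by rewrite invf_div.
  - by rewrite mulf_neq0 ?invr_eq0 ?expf_neq0.
exists k, u; split=> //; rewrite (ltnW ke) andbT lt0n; apply/eqP => k0.
by apply: nVpi; rewrite E k0 mul1r.
Qed.

(** In [x ^ N - 1 = (x - 1) * \sum_i x ^ i] each summand is 1 modulo [pi], so the sum is [N] modulo
    [pi] and contributes one more factor [pi]. *)
Lemma congruence_power_lift N x k : M N%:R ->
  V ((x - 1) / pi ^+ k.+1) -> V ((x ^+ N - 1) / pi ^+ k.+2).
Proof.
move=> MN Vx; set y := (x - 1) / pi ^+ k.+1 in Vx.
have Vpi : V pi by have [] := (maximal_idealE pi).1 Mpi.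
have xE : x = 1 + pi ^+ k.+1 * y by rewrite /y mulrC divfK ?expf_neq0 // addrC subrK.
have Vx' : V x.
  by rewrite xE; apply: subringD (subring1 Vr) _ => //; apply: subringM => //; apply: subringX.
have Sx i : V ((x ^+ i - 1) / pi).
  apply: subring_sub1X => //; rewrite xE addrAC subrr add0r exprS.
  have -> : pi * pi ^+ k * y / pi = pi ^+ k * y by field.
  by apply: subringM => //; apply: subringX.
rewrite subrX1 (exprS pi k.+1).
have -> : (x - 1) * (\sum_(i < N) x ^+ i) / (pi * pi ^+ k.+1) =
    y * ((\sum_(i < N) x ^+ i) / pi).
  by rewrite /y invfM; move: (\sum_(i < N) _) => S; ring.
apply: subringM => //.
have -> : \sum_(i < N) x ^+ i = \sum_(i < N) (x ^+ i - 1) + N%:R.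
  by rewrite sumrB sumr_const card_ord subrK.
rewrite mulrDl; apply: subringD => //; last exact: piP.
by rewrite mulr_suml; apply: subring_sum.
Qed.

End Uniformizer.

(** In [t], one factor [B!] makes units congruent to 1 modulo [pi], and [e] further factors [B!]
    lift this to [pi ^ e.+1], hence modulo [p]. The factor [e!] makes [t] a multiple of the
    ramification index [k <= e], so that [x ^ t] has the value of a power of [p], unless [x] is too
    divisible by [pi]. *)
Lemma uniform_exponent B :
  (forall w, V w -> ~ M w -> M (w ^+ B`! - 1)) -> M (B`!)%:R ->
  forall t, t = (B`! ^ e.+1 * e`!)%N ->
  forall x s, V x -> V (x ^+ t / p ^+ s) ->
    V (x ^+ t / p ^+ s.+1) \/ V (((x ^+ t / p ^+ s) ^+ t - 1) / p).
Proof.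
move=> HB MB t tE x s Vx Vxs.
have [pi Mpi [pi0 piP]] := bounded_ramification_uniformizer.
have [k [eta [/andP [k0 ke] Veta Vetai eta0 pE]]] := ramification_index Mpi pi0 piP.
have Vpi : V pi by have [] := (maximal_idealE pi).1 Mpi.
have t0 : (0 < t)%N by rewrite tE muln_gt0 expn_gt0 !fact_gt0.
have pow_unit w : V w -> V w^-1 -> w != 0 -> V ((w ^+ t - 1) / p).
  move=> Vw Vwi w0.
  have nMw : ~ M w by move/maximal_idealE => [_ [/eqP|//]]; rewrite (negbTE w0).
  have lift n : V (((w ^+ B`!) ^+ (B`! ^ n) - 1) / pi ^+ n.+1).
    elim: n => [|n IHn]; first by apply: piP; apply: HB.
    by rewrite expnSr exprM; apply: congruence_power_lift.
  rewrite tE expnS exprM exprM; apply: subring_sub1X => //.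
    by do 2!apply: (subringX Vr).
  have -> : ((w ^+ B`!) ^+ (B`! ^ e) - 1) / p =
    ((w ^+ B`!) ^+ (B`! ^ e) - 1) / pi ^+ e.+1 * (pi ^+ (e.+1 - k) * eta^-1).
    have -> : pi ^+ e.+1 = pi ^+ k * pi ^+ (e.+1 - k).
      by rewrite -exprD subnKC // (leq_trans ke).
    by rewrite pE; field; rewrite ?eta0 ?expf_neq0.
  apply: subringM => //; apply: subringM => //; exact: subringX.
(* [pi ^ (k * s.+1)] is [p ^ s.+1] up to a unit; if it divides [x], it divides [x ^ t] too, as
   [t > 0]. *)
have [Vxp|[j [u [_ Vu Vui u0 xE]]]] := uniformizer_factor pi0 piP (k * s.+1) Vx.
  left; case: (t) t0 => // t' _; rewrite exprSr -mulrA; apply: subringM => //.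
    exact: subringX.
  have -> : x / p ^+ s.+1 = x / pi ^+ (k * s.+1) * eta^-1 ^+ s.+1.
    by rewrite pE exprMn -exprM exprVn; field; rewrite expf_neq0 // expf_neq0.
  by apply: subringM => //; apply: subringX.
have [q tq] : exists q, t = (k * q)%N.
  suff : (k %| t)%N by case/dvdnP => q ->; exists q; rewrite mulnC.
  by rewrite tE dvdn_mull // dvdn_fact // k0.
pose h := u ^+ t * eta^-1 ^+ (j * q).
have Vh : V h by apply: subringM => //; apply: subringX.
have Vhi : V h^-1.
  by rewrite invfM -!exprVn invrK; apply: subringM => //; apply: subringX.
have h0 : h != 0 by rewrite mulf_neq0 ?expf_neq0 ?invr_eq0.
have xtE : x ^+ t = p ^+ (j * q) * h.
  rewrite /h xE exprMn pE exprMn -!exprM {1}tq exprVn.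
  have -> : (j * (k * q) = k * (j * q))%N by rewrite mulnCA.
  by field; rewrite expf_neq0.
(* Now [x ^ t] is [p ^ (j * q)] times the unit [h]. An exponent below [s] would make [p] a unit;
   equality gives the second alternative, a larger exponent the first. *)
have [ltjs|] := ltnP (j * q) s.
  case: nVpi; have -> : p^-1 = p ^+ (s - (j * q).+1) * (x ^+ t / p ^+ s) * h^-1.
    rewrite xtE -{2}(subnKC ltjs) exprD exprS; field.
    by rewrite h0 p0 /= !expf_neq0.
  apply: subringM => //; apply: subringM => //; exact: subringX.
rewrite leq_eqVlt => /orP [/eqP sE|ltsj]; [right | left].
  by rewrite xtE -sE mulrAC divff ?mul1r ?expf_neq0 //; apply: pow_unit.
have -> : x ^+ t / p ^+ s.+1 = p ^+ (j * q - s.+1) * h.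
  by rewrite xtE -{1}(subnKC ltsj) exprD; field; rewrite expf_neq0.
by apply: subringM => //; apply: subringX.
Qed.

End ValuationRings.

(** * Residue fields of bounded degree *)

Section ResiduePigeonhole.
Variables (L : fieldType) (V M R0 P0 : set L) (n f q : nat) (cls : L -> 'I_q).
Hypotheses (V_val : valuation_ring V) (M_max : maximal_ideal V M).
Hypothesis cls_inj : forall c c', R0 c -> R0 c' -> cls c = cls c' -> P0 (c - c').
Hypothesis P0M : P0 `<=` M.
Hypothesis nf : (n <= f)%N.
Hypothesis deg : residue_degree R0 P0 V M n.

Let Vr : subring V := V_val.1.
Let M_ideal : ideal V M. Proof. by case: M_max. Qed.

(** Coordinates in a basis of the residue field label each [y i] by [n <= f] classes out of [q].
    There are at most [q ^ f] labels, so two of the first [q ^ f + 1] elements share one. *)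
Lemma residue_pigeonhole (y : nat -> L) : (forall i, V (y i)) ->
  exists i j, [/\ (i < j)%N, (j <= q ^ f)%N & M (y j - y i)].
Proof.
move=> Vy; have [e [Ve spane _]] := deg; have [MV M0 MD MM] := M_ideal.
have /choice [c cP] i : exists c : 'I_n -> L,
    (forall j, R0 (c j)) /\ M (y i - \sum_j c j * e j).
  by have [c] := spane _ (Vy i); exists c.
pose lab (i : 'I_(q ^ f).+1) := [ffun j => cls (c i j)].
have q0 : (0 < q)%N by case: (cls 0) => m; apply: leq_trans.
have : ~~ injectiveb lab.
  apply/negP => /injectiveP /leq_card; rewrite card_ord card_ffun !card_ord.
  by rewrite ltnNge leq_pexp2l.
case/injectivePn => i [j ij eqlab].
wlog ltij : i j ij eqlab / (i < j)%N.
  move=> H; have [|lt|/val_inj eqij] := ltngtP i j; first exact: H.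
    by apply: (H j i) => //; rewrite eq_sym.
  by rewrite eqij eqxx in ij.
exists i, j; split=> //; first by rewrite -ltnS.
have -> : y j - y i = (y j - \sum_k c j k * e k) + (- 1) * (y i - \sum_k c i k * e k)
    + \sum_k e k * (c j k - c i k).
  have -> : \sum_k e k * (c j k - c i k) = \sum_k c j k * e k - \sum_k c i k * e k.
    by rewrite -sumrB; apply: eq_bigr => k _; ring.
  ring.
have [_ Mj] := cP j; have [_ Mi] := cP i.
apply: (MD); first apply: (MD) => //.
  by apply: MM => //; apply: subringN => //; apply: subring1.
elim/big_ind: _ => // k _; apply: MM => //; apply/P0M/cls_inj.
- by have [] := cP j.
- by have [] := cP i.
- by have /ffunP /(_ k) := eqlab; rewrite !ffunE.
Qed.

(** Two of the integers from 0 to [q ^ f] agree modulo [M], and their difference divides the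
    factorial. *)
Lemma residue_field_fact : M ((q ^ f)`!)%:R.
Proof.
have [MV M0 MD MM] := M_ideal.
have [i [j [ij jq]]] := residue_pigeonhole (subring_nat Vr).
rewrite -natrB ?(ltnW ij) // => Mij.
have : (j - i %| (q ^ f)`!)%N.
  by rewrite dvdn_fact // subn_gt0 ij (leq_trans (leq_subr _ _)).
by case/dvdnP => k ->; rewrite natrM; apply: MM => //; apply: subring_nat.
Qed.

(** Two powers of [w] agree modulo [M]. The factorial is a multiple of the difference of exponents,
    whatever the degree [n <= f] is. *)
Lemma residue_unit_exponent w : V w -> ~ M w -> M (w ^+ (q ^ f)`! - 1).
Proof.
move=> Vw nMw; have [MV M0 MD MM] := M_ideal.
have w0 : w != 0 by apply: contra_notN nMw => /eqP ->.
have Vwi := maximal_ideal_unit V_val M_max Vw nMw.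
have [i [j [ij jq Mij]]] := residue_pigeonhole (fun i => subringX Vr i Vw).
have M1 : M (w ^+ (j - i) - 1).
  have -> : w ^+ (j - i) - 1 = w^-1 ^+ i * (w ^+ j - w ^+ i).
    rewrite -{2}(subnKC (ltnW ij)) exprD exprVn mulrBr mulKf ?expf_neq0 //.
    by rewrite mulVf // expf_neq0.
  by apply: MM => //; apply: subringX.
have : (j - i %| (q ^ f)`!)%N.
  by rewrite dvdn_fact // subn_gt0 ij (leq_trans (leq_subr _ _)).
case/dvdnP => k ->; rewrite mulnC exprM subrX1 mulrC; apply: MM => //.
by apply: subring_sum => // l; do 2!apply: (subringX Vr).
Qed.

End ResiduePigeonhole.

(** * Inverses modulo [p] in a family of valuation rings *)

Section LocalInverse.
Variables (L : fieldType) (A : set L) (F : set (set L)) (p : L) (t n : nat).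
Variable g : 'I_n -> L.
Hypotheses (Ar : subring A) (Api : A p^-1) (p0 : p != 0) (t0 : (0 < t)%N).
Hypothesis F_val : forall V, F V -> valuation_ring V.
Hypothesis F_p : forall V, F V -> V p.
Hypothesis F_exp : forall V, F V -> forall x s, V x -> V (x ^+ t / p ^+ s) ->
  V (x ^+ t / p ^+ s.+1) \/ V (((x ^+ t / p ^+ s) ^+ t - 1) / p).
Hypothesis Ag : forall j, A (g j).
Hypothesis Fg : forall V, F V -> forall j, V (g j).

(* On a ring [V] where [u = 1] modulo [p], every generator with index below [m]
   has value at least [s + 1], in units of [v p / t], and the other ones have
   value at least [s]; where [u = 0] modulo [p] the [z j] already give an
   inverse modulo [p]. *)
Definition partial_inverse (s m : nat) (z : 'I_n -> L) (u : L) : Prop :=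
  [/\ A u /\ (forall j, A (z j)),
      \sum_j z j * g j = 1 - u,
      forall V, F V -> forall i j, V (z j * g i)
    & forall V, F V -> V (u / p) \/
        V ((u - 1) / p) /\ forall i : 'I_n,
          V (g i ^+ t / p ^+ s) /\ ((i < m)%N -> V (g i ^+ t / p ^+ s.+1))].

(** Replace [u] by [u * (1 - w ^ t)] and add to [z k] the [c] with [c * g k = u * w ^ t]. Where
    [u = 0] modulo [p], this persists. Where [u = 1], either [p ^ s.+1] divides [g k ^ t], so that
    [w = 0] and the new [u] is still 1, or [w ^ t = 1] and the new [u] is 0, all modulo [p]. *)
Lemma partial_inverse_step s (k : 'I_n) z u : partial_inverse s k z u ->
  exists z' u', partial_inverse s k.+1 z' u'.
Proof.
move=> [[Au Az] sumz Vz Hu].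
have expt (x : L) : x ^+ t = x ^+ t.-1 * x by rewrite -exprSr prednK.
(* Where [p] divides [u], the power [u ^ s] absorbs the denominator [p ^ s] and one factor [u] is
   left over. *)
pose b := u ^+ s.+1 * (g k ^+ t.-1 / p ^+ s).
pose w := b * g k.
have wE : w = u ^+ s.+1 * (g k ^+ t / p ^+ s).
  by rewrite /w /b (expt (g k)); ring.
pose c := u * w ^+ t.-1 * b.
have cE : c * g k = u * w ^+ t.
  by rewrite /c (expt w) {3}/w; ring.
pose z' j := if j == k then z j + c else z j.
have Ab : A b.
  by do ![apply: (subringM Ar) | apply: (subringX Ar) | rewrite -exprVn].
have Aw : A w by apply: subringM.
have Ac : A c by do 2?apply: (subringM Ar) => //; apply: subringX.
have Vu V : F V -> V u.
  move=> FV; have Vr := (F_val FV).1.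
  case: (Hu V FV) => [Vu|[Vu _]].
    by rewrite -(divfK p0 u); apply: subringM => //; apply: F_p.
  rewrite -(subrK 1 u) -(divfK p0 (u - 1)).
  by apply: subringD (subring1 Vr) => //; apply: subringM => //; apply: F_p.
(* [w] is divisible by [p] where [u] is; elsewhere it is integral because no
   generator was of value less than [s]. *)
have Vb V : F V -> forall i, V (b * g i).
  move=> FV i; have Vr := (F_val FV).1.
  case: (Hu V FV) => [Vup|[_ Vgs]].
    have -> : b * g i = (u / p) ^+ s * u * g k ^+ t.-1 * g i.
      by rewrite /b exprMn exprVn exprS; ring.
    by do ![exact: Vup | exact: Vu | exact: Fg | apply: (subringM Vr) | apply: (subringX Vr)].
  rewrite /b -mulrA; apply: subringM => //; first by apply: subringX => //; apply: Vu.
  (* Only [t]-th powers of generators are known to be divisible by [p ^ s], so integrality is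
     checked on the [t]-th power. *)
  apply: (valuation_ring_root (F_val FV) t0).
  have -> : (g k ^+ t.-1 / p ^+ s * g i) ^+ t =
      (g k ^+ t / p ^+ s) ^+ t.-1 * (g i ^+ t / p ^+ s).
    by rewrite !exprMn exprAC (expt (p ^+ s)^-1); ring.
  by apply: subringM => //; [apply: subringX => //; case: (Vgs k) | case: (Vgs i)].
have Vw V : F V -> V w by move=> FV; apply: Vb.
exists z', (u * (1 - w ^+ t)); split.
- split=> [|j]; last by rewrite /z'; case: eqP => // _; apply: subringD.
  apply: subringM => //; apply: subringB => //; first exact: subring1.
  exact: subringX.
- rewrite (bigD1 k) //= /z' eqxx.
  under eq_bigr => j jk do rewrite (negbTE jk).
  by move: sumz; rewrite (bigD1 k) //= mulrDl cE addrAC => ->; ring.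
- move=> V FV i j; have Vr := (F_val FV).1; rewrite /z'; case: eqP => _; last exact: Vz.
  rewrite mulrDl; apply: subringD => //; first exact: Vz.
  rewrite /c -mulrA; apply: subringM => //; last exact: Vb.
  by apply: subringM => //; [exact: Vu | apply: subringX => //; exact: Vw].
- move=> V FV; have Vr := (F_val FV).1; have V1 := subring1 Vr.
  have Vwt : V (w ^+ t) by apply: subringX => //; exact: Vw.
  case: (Hu V FV) => [Vup|[Vup Vgs]].
    by left; rewrite mulrAC; apply: subringM => //; apply: subringB.
  have [Vgks _] := Vgs k.
  case: (F_exp FV (Fg FV k) Vgks) => [Vgk|Vgk].
    right; split.
      have -> : (u * (1 - w ^+ t) - 1) / p = (u - 1) / p -
          u * w ^+ t.-1 * u ^+ s.+1 * (g k ^+ t / p ^+ s.+1).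
        by rewrite (expt w) {2}wE [p ^+ s.+1]exprSr invfM; ring.
      apply: subringB => //; apply: subringM => //.
      by do ![exact: Vu | exact: Vw | apply: (subringM Vr) | apply: (subringX Vr)].
    move=> i; split=> [|]; first by case: (Vgs i).
    rewrite ltnS leq_eqVlt => /orP [/eqP/val_inj ->|] //.
    by case: (Vgs i).
  left; rewrite -mulrA; apply: subringM => //; first exact: Vu.
  set h := g k ^+ t / p ^+ s in wE Vgks Vgk.
  have -> : (1 - w ^+ t) / p =
      - (((u ^+ (s.+1 * t)) - 1) / p * h ^+ t + (h ^+ t - 1) / p).
    by rewrite wE exprMn -exprM; ring.
  apply: subringN => //; apply: subringD => //; apply: subringM => //; last exact: subringX.
  by apply: subring_sub1X => //; exact: Vu.
Qed.

(** Start from [z = 0], [u = 1] at [s = 0]; after all generators are treated, [partial_inverse s n]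
    yields [partial_inverse s.+1 0]. At [s = c] the hypothesis rules out the rings with [u = 1]
    modulo [p], so [p] divides [u] everywhere. *)
Lemma local_inverse c :
  (forall V, F V -> exists j, ~ V (g j ^+ t / p ^+ c)) ->
  exists (z : 'I_n -> L) u, [/\ A u, (forall j, A (z j)), \sum_j z j * g j = 1 - u,
    forall V, F V -> forall i j, V (z j * g i) & forall V, F V -> V (u / p)].
Proof.
move=> Hc.
have step s m : (m <= n)%N -> (exists z u, partial_inverse s 0 z u) ->
    exists z u, partial_inverse s m z u.
  move=> + H0; elim: m => // m IHm mn.
  have [z [u Hzu]] := IHm (ltnW mn).
  exact: (@partial_inverse_step s (Ordinal mn) z u).
have Hs s : exists z u, partial_inverse s 0 z u.
  elim: s => [|s IHs].
    exists (fun _ => 0), 1; split.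
    - by split=> [|_]; [apply: subring1 | apply: subring0].
    - by rewrite big1 ?subrr // => j _; rewrite mul0r.
    - by move=> V FV i j; rewrite mul0r; apply: subring0 (F_val FV).1.
    - move=> V FV; have Vr := (F_val FV).1; right; rewrite subrr mul0r.
      split=> [|i]; first exact: subring0.
      by split=> //; rewrite divr1; apply: subringX => //; apply: Fg.
  have [z [u [Azu sumz Vz Hu]]] := step s n (leqnn n) IHs.
  exists z, u; split=> // V FV; have [|[? Hi]] := Hu V FV; first by left.
  by right; split=> // i; split=> //; case: (Hi i) => _; apply.
have [z [u [[Au Az] sumz Vz Hu]]] := Hs c.
exists z, u; split=> // V FV; have [//|[_ Hi]] := Hu V FV.
by have [j []] := Hc V FV; case: (Hi j).
Qed.

End LocalInverse.

(** * Prime ideals of almost Dedekind domains *)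

Section PrimeIdeals.
Variables (L : fieldType) (R : set L).
Hypothesis Rr : subring R.

Lemma ideal_adjoin Q x : ideal R Q -> R x ->
  ideal R [set y | exists q r, [/\ Q q, R r & y = q + r * x]].
Proof.
move=> [QR Q0 QD QM] Rx; split.
- by move=> _ [q [r [Qq Rq ->]]]; apply: subringD => //; [apply: QR | apply: subringM].
- by exists 0, 0; split; rewrite ?mul0r ?addr0 //; apply: subring0.
- move=> _ _ [q [r [Qq Rq ->]]] [q' [r' [Qq' Rq' ->]]].
  by exists (q + q'), (r + r'); split; [apply: QD | apply: subringD | ring].
- move=> a _ Ra [q [r [Qq Rq ->]]].
  by exists (a * q), (a * r); split; [apply: QM | apply: subringM | ring].
Qed.

(** Used twice: with [S] reduced to 1 for maximal ideals, and with the nonzero elements of [D0] for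
    denominators. *)
Lemma exists_maximal_avoiding (S I : set L) : ideal R I -> (forall x, I x -> ~ S x) ->
  exists Q, [/\ ideal R Q, I `<=` Q, forall x, Q x -> ~ S x
    & forall J, ideal R J -> (forall x, J x -> ~ S x) -> Q `<=` J -> J = Q].
Proof.
move=> I_ideal IS; have [IR I0 ID IM] := I_ideal.
(* The empty chain has union [set0], hence the union with [I]. *)
pose C := [set A : set L | ideal R (A `|` I) /\ forall x, (A `|` I) x -> ~ S x].
have [F FC Ftot|A [[A_ideal AS] Amax]] := @Zorn_bigcup L C.
  have chain x y : (\bigcup_(X in F) X `|` I) x -> (\bigcup_(X in F) X `|` I) y ->
      exists2 X : set L, C X /\ (X `|` I `<=` \bigcup_(X in F) X `|` I) &
        (X `|` I) x /\ (X `|` I) y.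
    have sub X : F X -> X `|` I `<=` \bigcup_(X in F) X `|` I.
      by move=> FX z [Xz|Iz]; [left; exists X | right].
    move=> [[X FX Xx]|Ix] [[Y FY Yy]|Iy].
    + case: (Ftot _ _ FX FY) => XY.
        by exists Y; split; [exact: FC|exact: sub|left; apply: XY|left].
      by exists X; split; [exact: FC|exact: sub|left|left; apply: XY].
    + by exists X; split; [exact: FC|exact: sub|left|right].
    + by exists Y; split; [exact: FC|exact: sub|right|left].
    + exists set0; last by split; right.
      by split; [rewrite /C mksetE set0U | move=> z [|Iz]; right].
  split; last first.
    by move=> x /[dup] Hx /chain /(_ Hx) [X [[_ XS] _] [Xx _]]; apply: XS.
  split.
  - by move=> x /[dup] Hx /chain /(_ Hx) [X [[[XR _ _ _] _] _] [Xx _]]; apply: XR.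
  - by right.
  - move=> x y /chain H /H [X [[[_ _ XD _] _] sub] [Xx Xy]].
    by apply: sub; apply: XD.
  - move=> r x Rr' /[dup] Hx /chain /(_ Hx) [X [[[_ _ _ XM] _] sub] [Xx _]].
    by apply: sub; apply: XM.
exists (A `|` I); split=> // J J_ideal JS AJ.
have JI : J `|` I = J.
  by apply/seteqP; split=> x; [case=> // Ix; apply: AJ; right | left].
apply/seteqP; split=> // x Jx; left; apply: contrapT => nAx.
apply: (Amax J); last by rewrite /C mksetE JI.
by split=> [y Ay|JA]; [apply: AJ; left | apply/nAx/JA].
Qed.

Lemma maximal_avoiding_prime (S Q : set L) : S 1 ->
  (forall x y, S x -> S y -> S (x * y)) -> ideal R Q -> (forall x, Q x -> ~ S x) ->
  (forall J, ideal R J -> (forall x, J x -> ~ S x) -> Q `<=` J -> J = Q) ->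
  prime_ideal R Q.
Proof.
move=> S1 SM Q_ideal QS Qmax; have [QR Q0 QD QM] := Q_ideal.
have meet x : R x -> ~ Q x -> exists q r, [/\ Q q, R r & S (q + r * x)].
  move=> Rx nQx; apply: contrapT => nS.
  have E := Qmax _ (ideal_adjoin Q_ideal Rx); apply: nQx; rewrite -E.
  - by exists 0, 1; split; rewrite ?mul1r ?add0r //; apply: subring1.
  - by move=> _ [q [r [Qq Rr' ->]]] Sy; apply: nS; exists q, r.
  - by move=> q Qq; exists q, 0; split; rewrite ?mul0r ?addr0 //; apply: subring0.
split=> // [Q1|x y Rx Ry Qxy]; first exact: QS Q1 S1.
have [|nQx] := pselect (Q x); first by left.
have [|nQy] := pselect (Q y); first by right.
have [q [r [Qq Rr' Sx]]] := meet x Rx nQx.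
have [q' [r' [Qq' Rr'' Sy]]] := meet y Ry nQy.
case: (QS _ _ (SM _ _ Sx Sy)).
have -> : (q + r * x) * (q' + r' * y) = (q' + r' * y) * q + (r * x * q' + r * r' * (x * y)).
  ring.
have RMx : R (r * x) by apply: subringM.
have RMy : R (r' * y) by apply: subringM.
apply: (QD); first by apply: QM => //; apply: subringD => //; apply: QR.
by apply: QD; apply: QM => //; apply: subringM.
Qed.

Lemma exists_maximal_ideal I : ideal R I -> ~ I 1 -> exists2 Q, Max R Q & I `<=` Q.
Proof.
move=> I_ideal nI1.
have [|Q [Q_ideal IQ QS Qmax]] := @exists_maximal_avoiding [set 1] I I_ideal.
  by move=> x Ix xE; apply: nI1; rewrite -xE.
exists Q => //; split=> // [Q1|J J_ideal nJ1]; first exact: (QS 1).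
by apply: Qmax => // x Jx xE; apply: nJ1; rewrite -xE.
Qed.

Lemma Max_prime Q : Max R Q -> prime_ideal R Q.
Proof.
move=> [Q_ideal nQ1 Qmax].
apply: (@maximal_avoiding_prime [set 1]) => //.
- by move=> _ _ -> ->; rewrite mul1r.
- by move=> x Qx xE; apply: nQ1; rewrite -xE.
- move=> J J_ideal JS; apply: Qmax => // J1; exact: (JS 1).
Qed.

Lemma prime_idealX Q x n : prime_ideal R Q -> R x -> Q (x ^+ n) -> Q x.
Proof.
move=> [_ nQ1 QP] Rx; elim: n => [|n IHn]; first by rewrite expr0.
by rewrite exprS => /QP [] //; apply: subringX.
Qed.

Lemma Max_nonzero_prime Q : not_a_field R -> Max R Q -> nonzero_prime_ideal R Q.
Proof.
move=> [x Rx [x0 nRxi]] QM; split; first exact: Max_prime.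
move=> Q0; have [Q_ideal nQ1 Qmax] := QM; have [QR Qz QD QMul] := Q_ideal.
have E : [set y | exists q r, [/\ Q q, R r & y = q + r * x]] = Q.
  apply: Qmax; first exact: ideal_adjoin.
  - move=> [q [r [Qq Rr' E1]]]; apply: nRxi.
    have -> // : x^-1 = r.
    by apply: (mulIf x0); rewrite mulVf // E1; move: Qq; rewrite Q0 => ->; rewrite add0r.
  - by move=> q Qq; exists q, 0; split; rewrite ?mul0r ?addr0 //; apply: subring0.
have : Q x by rewrite -E; exists 0, 1; split; rewrite ?mul1r ?add0r //; apply: subring1.
by rewrite Q0 /= => /eqP; rewrite (negbTE x0).
Qed.

End PrimeIdeals.

Section IntValuation.
Variables (L : fieldType) (v : L -> int).
Hypothesis v_val : valuation v.

Lemma valuationM x y : x != 0 -> y != 0 -> v (x * y) = v x + v y.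
Proof. by have [_ + _] := v_val; apply. Qed.

Lemma valuation1 : v 1 = 0.
Proof.
by apply: (addrI (v 1)); rewrite -valuationM ?oner_neq0 // mulr1 addr0.
Qed.

Lemma valuationV x : x != 0 -> v x^-1 = - v x.
Proof.
move=> x0; apply: (addrI (v x)).
by rewrite -valuationM ?invr_eq0 // divff // subrr valuation1.
Qed.

Lemma valuationX x n : x != 0 -> v (x ^+ n) = v x *+ n.
Proof.
move=> x0; elim: n => [|n IHn]; first by rewrite valuation1.
by rewrite exprS valuationM ?expf_neq0 // IHn mulrS.
Qed.

End IntValuation.

Section AlmostDedekind.
Variables (K : fieldType) (D : set K).
Hypothesis D_aD : almost_Dedekind D.

Let Dr : subring D. Proof. by case: D_aD. Qed.

(** Let [M] be a maximal ideal over [P] and [y] a nonzero element of [P]. A nonzero [x] in [M] has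
    [v x >= 1], so [x ^ n / y] lies in [D_M] for [n = |v y|]. Thus [s * x ^ n] is in [P] for some
    [s] outside [M], and [x] is in [P]. *)
Lemma almost_Dedekind_prime_maximal P : nonzero_prime_ideal D P -> Max D P.
Proof.
move=> [P_prime Pn0]; have [P_ideal nP1 PP] := P_prime.
have [PD P0 PDD PM] := P_ideal.
have [M MM PsubM] := exists_maximal_ideal P_ideal nP1.
suff -> : P = M by [].
have [M_ideal nM1 M_max] := MM; have [MD M0 MDD MMul] := M_ideal.
have [y Py y0] : exists2 y, P y & y != 0.
  apply: contrapT => H; apply: Pn0; apply/seteqP; split=> [y Py|_ -> //].
  by apply: contrapT => /eqP yn0; apply: H; exists y.
have [_ _ /(_ M MM) [v [v_val _] locE]] := D_aD.
have in_loc z : z != 0 -> 0 <= v z -> localization D M z by move=> _ vz; rewrite locE; right.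
apply/seteqP; split=> // x Mx.
have [->//|x0] := eqVneq x 0.
(* Otherwise [x^-1 = a / s] with [s] outside [M], although [s = a * x] lies in [M]. *)
have vx : 1 <= v x.
  rewrite leNgt; apply/negP; rewrite (_ : (v x < 1) = (v x <= 0)); last first.
    by rewrite -[X in _ < X]add0r ltzD1.
  rewrite -oppr_ge0 -(valuationV v_val x0) => /in_loc.
  rewrite invr_eq0 => /(_ x0) [a [s [Da Ds nMs xE]]]; apply: nMs.
  have s0 : s != 0.
    by apply/eqP => s0; move/eqP: xE; rewrite s0 invr0 mulr0 invr_eq0 (negbTE x0).
  have -> : s = a * x.
    by apply: (mulIf (invr_neq0 x0)); rewrite mulfK // xE mulrC divfK.
  exact: MMul.
pose n := `|v y|%N.
have : 0 <= v (x ^+ n / y).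
  rewrite valuationM ?expf_neq0 ?invr_eq0 // valuationV // valuationX // subr_ge0.
  apply: (@le_trans _ _ (n%:Z)); first by rewrite /n abszE ler_norm.
  rewrite -[X in X <= _]mul1r -mulr_natr natz; exact: ler_wpM2r.
move/in_loc; rewrite mulf_neq0 ?invr_eq0 ?expf_neq0 // => /(_ isT) [a [s [Da Ds nMs xE]]].
have s0 : s != 0 by apply: contra_notN nMs => /eqP ->.
have : P (s * x ^+ n).
  have -> : s * x ^+ n = a * y.
    rewrite -[x ^+ n](divfK y0) xE; by field.
  exact: PM.
have Dx := MD _ Mx.
case/PP => //; first exact: subringX.
  by move/PsubM.
exact: (prime_idealX Dr P_prime).
Qed.

(** * Denominators in the base ring *)

Variable D0 : set K.
Hypotheses (D0r : subring D0) (D0D : D0 `<=` D) (D0inf : infinite_set D0).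
Hypothesis D_fin : finite_residue_fields D.
Hypothesis D_quot : quotient_field D = [set: K].

Lemma residue_classifier P : Max D P ->
  exists q (cls : K -> 'I_q), forall c c', D c -> D c' -> cls c = cls c' -> P (c - c').
Proof.
move=> PM; have [[PD P0 PDD PMul] _ _] := PM.
have [q /card_set_bijP [f [f_fun f_inj _]]] := D_fin PM.
pose C (x : K) : set K := [set y | P (y - x)].
have lt x : D x -> (f (C x) < q)%N by move=> Dx; apply: f_fun; exists x.
(* The class of 0 excludes [q = 0], as [inord] needs a nonempty ordinal type. *)
case: q {f_fun} lt => [|q] lt; first by have := lt 0 (subring0 Dr).
exists q.+1, (fun x => inord (f (C x))) => c c' Dc Dc' /(congr1 val).
rewrite /= !inordK ?lt // => /f_inj E.
have : C c' c; last by [].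
have <- : C c = C c' by apply: E; apply/mem_set; [exists c | exists c'].
by rewrite /C /= subrr.
Qed.

(** Otherwise the infinite ring [D0] would embed into the finite residue field of [P]. *)
Lemma Max_meets_base P : Max D P -> exists2 c, D0 c & P c /\ c != 0.
Proof.
move=> PM; have [q [cls clsP]] := residue_classifier PM.
apply: contrapT => H; apply: D0inf.
pose rep i := xget 0 [set c | D0 c /\ cls c = i].
apply: sub_finite_set (finite_image rep (@finite_finset _ [set: 'I_q])).
move=> c D0c; exists (cls c) => //.
have [|D0r' Er] := @xgetPex _ 0 [set c' | D0 c' /\ cls c' = cls c]; first by exists c.
rewrite -/(rep (cls c)) in D0r' Er.
apply/eqP; rewrite -subr_eq0; apply/negPn/negP => n0; apply: H.
exists (rep (cls c) - c); first exact: subringB.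
by split=> //; apply: clsP => //; apply: D0D.
Qed.

(** Let [b] be a denominator of [c]. If [bD] contained no nonzero element of [D0], an ideal over
    [bD] maximal with this property would be a nonzero prime, hence maximal, and would meet [D0]
    after all. *)
Lemma base_denominator c : exists2 d, D0 d & d != 0 /\ D (d * c).
Proof.
have [a [b [Da Db b0 ->]]] : quotient_field D c by rewrite D_quot.
suff [d D0d [d0 Ddb]] : exists2 d, D0 d & d != 0 /\ D (d / b).
  by exists d => //; split=> //; rewrite mulrCA; apply: subringM.
apply: contrapT => H.
pose S := D0 `\ 0.
pose J := principal_ideal D b.
have J_ideal : ideal D J.
  split.
  - by move=> _ [r Dr' <-]; apply: subringM.
  - by exists 0; rewrite ?mulr0 //; apply: subring0.
  - by move=> _ _ [r Dr' <-] [s Ds <-]; exists (r + s); rewrite ?mulrDr //; apply: subringD.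
  - by move=> s _ Ds [r Dr' <-]; exists (s * r); rewrite 1?mulrCA //; apply: subringM.
have JS x : J x -> ~ S x.
  move/(principal_idealP b0) => Dxb [D0x /eqP x0]; apply: H; exists x => //.
have [Q [Q_ideal JQ QS Qmax]] := exists_maximal_avoiding J_ideal JS.
have Q_prime : prime_ideal D Q.
  apply: (@maximal_avoiding_prime _ _ Dr S) => //.
    by split; [apply: subring1 | apply/eqP; rewrite oner_eq0].
  move=> x y [D0x /eqP x0] [D0y /eqP y0]; split; first exact: subringM.
  by apply/eqP; rewrite mulf_neq0.
have QM : Max D Q.
  apply: almost_Dedekind_prime_maximal; split=> // Q0.
  have : Q b by apply: JQ; exists 1; rewrite ?mulr1 //; apply: subring1.
  by rewrite Q0 /= => /eqP; rewrite (negbTE b0).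
have [x D0x [Qx x0]] := Max_meets_base QM.
by apply: (QS x Qx); split=> //; apply/eqP.
Qed.

Lemma base_common_denominator (s : seq K) :
  exists2 d, D0 d & d != 0 /\ forall c, c \in s -> D (d * c).
Proof.
elim: s => [|c s [d D0d [d0 dP]]].
  by exists 1; [exact: subring1 | rewrite oner_neq0].
have [d' D0d' [d'0 d'P]] := base_denominator c.
exists (d * d'); first exact: subringM.
split=> [|c']; first by rewrite mulf_neq0.
rewrite inE => /orP [/eqP ->|/dP Hc'].
  by rewrite -mulrA; apply: subringM => //; apply: D0D.
by rewrite mulrAC; apply: subringM => //; apply: D0D.
Qed.

End AlmostDedekind.

(** * Rational functions and inverses of ideals *)

Section RatfunConstants.
Variable K : fieldType.
Implicit Types (c d : K) (D : set K).

Lemma ratC1 : ratC (1 : K) = 1. Proof. exact: tofrac1. Qed.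
Lemma ratC0 : ratC (0 : K) = 0. Proof. exact: tofrac0. Qed.
Lemma ratCM c d : ratC (c * d) = ratC c * ratC d.
Proof. by rewrite /ratC polyCM tofracM. Qed.
Lemma ratCD c d : ratC (c + d) = ratC c + ratC d.
Proof. by rewrite /ratC polyCD tofracD. Qed.
Lemma ratCB c d : ratC (c - d) = ratC c - ratC d.
Proof. by rewrite /ratC polyCB tofracB. Qed.
Lemma ratCX c n : ratC (c ^+ n) = ratC c ^+ n.
Proof. by elim: n => [|n IHn]; rewrite ?ratC1 // !exprS ratCM IHn. Qed.
Lemma ratC_eq0 c : (ratC c == 0) = (c == 0).
Proof. by rewrite /ratC tofrac_eq0 polyC_eq0. Qed.
Lemma ratCV c : ratC c^-1 = (ratC c)^-1.
Proof.
have [->|c0] := eqVneq c 0; first by rewrite ratC0 !invr0 ratC0.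
have rc0 : ratC c != 0 by rewrite ratC_eq0.
by apply: (mulfI rc0); rewrite -ratCM !divff ?ratC1.
Qed.

Lemma ratC_inj : injective (@ratC K).
Proof.
by move=> c d /eqP; rewrite -subr_eq0 -ratCB ratC_eq0 subr_eq0 => /eqP.
Qed.

Lemma polys_over_ratC D c : subring D -> D c -> polys_over D (ratC c).
Proof.
by move=> Dr Dc; exists c%:P => // j; rewrite coefC; case: eqP => // _; apply: subring0.
Qed.

Lemma polys_over_subring D : subring D -> subring (polys_over D).
Proof.
move=> Dr; split.
- by rewrite -ratC1; apply: polys_over_ratC => //; apply: subring1.
- move=> _ _ [f Df ->] [g Dg ->]; exists (f - g); last by rewrite tofracB.
  by move=> j; rewrite coefB; apply: subringB.
- move=> _ _ [f Df ->] [g Dg ->]; exists (f * g); last by rewrite tofracM.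
  by move=> j; rewrite coefM; apply: subring_sum => // i; apply: subringM.
Qed.

Lemma subring_setT (L : fieldType) : subring [set: L]. Proof. by split. Qed.

(** [H] is a nonzero combination of least size; the remainder of each [G i] modulo [H] is again a
    combination, hence zero. *)
Lemma poly_family_bezout n (G : 'I_n -> {poly K}) j0 : G j0 != 0 ->
  exists H G' U, [/\ H != 0, forall j, G j = H * G' j & \sum_j U j * G' j = 1].
Proof.
move=> Gj0.
pose comb U := \sum_j U j * G j.
pose C m := `[<exists2 U, comb U != 0 & size (comb U) = m>].
have combD U i : comb (fun j => (j == i)%:R - U j) = G i - comb U.
  rewrite /comb; under eq_bigr => j _ do rewrite mulrBl.
  rewrite sumrB; congr (_ - _); rewrite (bigD1 i) //= eqxx mul1r big1 ?addr0 //.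
  by move=> j ji; rewrite (negbTE ji) mul0r.
have exC : exists m, C m.
  exists (size (G j0)); apply/asboolP; exists (fun j => (j == j0)%:R - 0).
    by rewrite (combD (fun _ => 0)) /comb big1 ?subr0 // => j _; rewrite mul0r.
  by rewrite (combD (fun _ => 0)) /comb big1 ?subr0 // => j _; rewrite mul0r.
case: (ex_minnP exC) => m /asboolP [U H0 sizeH] min_m.
set H := comb U in H0 sizeH.
have dvd i : (H %| G i)%R.
  rewrite /dvdp; apply/negPn/negP => nz.
  have E : comb (fun j => (j == i)%:R - (G i %/ H) * U j) = G i %% H.
    rewrite (combD (fun j => (G i %/ H) * U j)) /comb.
    under eq_bigr => j _ do rewrite -mulrA.
    by rewrite -mulr_sumr -/(comb U) -/H {1}(divp_eq (G i) H) addrAC subrr add0r.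
  have : C (size (G i %% H)).
    by apply/asboolP; exists (fun j => (j == i)%:R - (G i %/ H) * U j); rewrite E.
  by move/min_m; rewrite -sizeH leqNgt ltn_modp H0.
exists H, (fun j => G j %/ H), U; split=> // [j|]; first by rewrite mulrC divpK.
apply: (mulIf H0); rewrite mul1r mulr_suml; transitivity (comb U) => //.
by apply: eq_bigr => j _; rewrite -mulrA divpK.
Qed.

End RatfunConstants.

(** For [g] not all zero and a subring [R], this is the product of the ideal generated by [g] with
    its inverse. *)
Definition inverse_span (L : fieldType) (R : set L) n (g : 'I_n -> L) (x : L) : Prop :=
  exists2 z : 'I_n -> L, (forall i j, R (z j * g i)) & x = \sum_j z j * g j.

Section InverseSpan.
Variables (L : fieldType) (R : set L) (n : nat) (g : 'I_n -> L).
Hypothesis Rr : subring R.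

Lemma inverse_spanD x y :
  inverse_span R g x -> inverse_span R g y -> inverse_span R g (x + y).
Proof.
move=> [z Rz ->] [z' Rz' ->]; exists (fun j => z j + z' j).
  by move=> i j; rewrite mulrDl; apply: subringD.
by rewrite -big_split /=; apply: eq_bigr => j _; rewrite mulrDl.
Qed.

Lemma inverse_spanM r x : R r -> inverse_span R g x -> inverse_span R g (r * x).
Proof.
move=> Rr' [z Rz ->]; exists (fun j => r * z j).
  by move=> i j; rewrite -mulrA; apply: subringM.
by rewrite mulr_sumr; apply: eq_bigr => j _; rewrite mulrA.
Qed.

Lemma inverse_span_invertible : (forall j, R (g j)) -> (exists j, g j != 0) ->
  inverse_span R g 1 ->
  invertible_ideal R [set x | exists2 c : 'I_n -> L,
    (forall j, R (c j)) & x = \sum_j c j * g j].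
Proof.
move=> Rg [k gk0] [z Rz z1]; apply/seteqP; split=> [_ [s sP ->]|r Rr'].
  elim: s sP => [|u s IHs] sP; first by rewrite big_nil; apply: subring0.
  rewrite big_cons; apply: subringD => //.
    by have [? [_]] := sP u (mem_head _ _); rewrite mulrC; apply.
  by apply: IHs => v vs; apply: sP; rewrite inE vs orbT.
exists [seq (r * g j, z j) | j <- enum 'I_n].
  move=> _ /mapP [j _ ->] /=; split.
    exists (fun i => if i == j then r else 0).
      by move=> i; case: eqP => // _; apply: subring0.
    rewrite (bigD1 j) //= eqxx big1 ?addr0 // => i ij.
    by rewrite (negbTE ij) mul0r.
  split; first by exists (z j * g k), (g k); split=> //; rewrite mulfK.
  move=> _ [c Rc ->]; rewrite mulr_sumr; apply: subring_sum => // i.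
  by rewrite mulrCA; apply: subringM.
rewrite big_map big_enum /= -[LHS]mulr1 z1 mulr_sumr.
by apply: eq_bigr => j _; ring.
Qed.

End InverseSpan.

(** * Cancelling the primes of [D0] *)

(* Stated over an abstract field: conversion in the concrete field [ratfun K]
   is prohibitively slow. *)
Section FieldIdentities.
Variable L : fieldType.
Implicit Types a b d z : L.

Lemma mul_expVKf a b z n : a != 0 -> b * z = a^-1 ^+ n * (a ^+ n * b * z).
Proof. by move=> a0; rewrite exprVn -mulrA mulKf // expf_neq0. Qed.

Lemma invf_expSK a b n : a != 0 -> b != 0 -> a^-1 = a ^+ n * b / a ^+ n.+1 / b.
Proof. by move=> a0 b0; rewrite exprS; field; rewrite b0 a0 expf_neq0. Qed.

Lemma bezout_combination a b a' p d u : p != 0 -> a * b + a' * p = 1 ->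
  d = d * a * (b * (1 - u)) + (a * (b * (u / p)) + a') * (p * d).
Proof. by move=> p0 E; rewrite -[LHS]mulr1 -[X in _ * X = _]E; field. Qed.

Lemma mulfK_middle a b d z : a != 0 -> z * d / a * (a * b) = z * (d * b).
Proof. by move=> a0; field. Qed.

End FieldIdentities.

Section ExtendedValuation.
Variables (K : fieldType) (D P : set K) (vK : K -> int) (V : set (ratfun K)).
Hypotheses (Dr : subring D) (P_prime : prime_ideal D P).
Hypothesis vK_padic : padic_valuation D P vK.
Hypothesis V_ext : associated_valuation_extends V vK.

(** [iota] preserves and reflects signs, so integrality of a constant is read off from [vK], whose
    ring is [D_P]. *)
Lemma extended_valuation_ring_constants c :
  c != 0 -> V (ratC c) <-> localization D P c.
Proof.
move=> c0; have [G [v [iota [v_val -> iota_mono vE]]]] := V_ext.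
have rc0 : ratC c <> 0 by apply/eqP; rewrite ratC_eq0.
have [_ <-] := vK_padic; split=> [[//|]|[/eqP|vc]].
- by rewrite vE // -(raddf0 iota) iota_mono; right.
- by rewrite (negbTE c0).
- by right; rewrite vE // -(raddf0 iota) iota_mono.
Qed.

Lemma extended_valuation_unit c : D c -> ~ P c -> V (ratC c)^-1.
Proof.
move=> Dc nPc; have [[_ P0 _ _] _ _] := P_prime.
have c0 : c != 0 by apply: contra_notN nPc => /eqP ->.
rewrite -ratCV; apply/extended_valuation_ring_constants; rewrite ?invr_eq0 //.
by exists 1, c; split; rewrite ?mul1r //; apply: subring1.
Qed.

Lemma extended_valuation_nonunit c : c != 0 -> P c -> ~ V (ratC c)^-1.
Proof.
move=> c0 Pc; have [[_ P0 _ PM] _ _] := P_prime.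
rewrite -ratCV => /extended_valuation_ring_constants.
rewrite invr_eq0 => /(_ c0) [a [b [Da Db nPb E]]]; apply: nPb.
have b0 : b != 0.
  by apply: contra_eq_neq E => ->; rewrite invr0 mulr0 invr_eq0.
have -> : b = a * c; last exact: PM.
by apply: (mulIf (invr_neq0 c0)); rewrite mulfK // E mulrC divfK.
Qed.

End ExtendedValuation.

Section MainArgument.
Variables (K : fieldType) (D D0 : set K).
Hypothesis D_aD : almost_Dedekind D.
Hypothesis D_quot : quotient_field D = [set: K].
Hypothesis D_fin : finite_residue_fields D.
Hypothesis D0_base : base_PID D0.
Hypothesis D0D : D0 `<=` D.
Variable vP : set K -> K -> int.
Hypothesis vP_padic : forall P, nonzero_prime_ideal D P -> padic_valuation D P (vP P).
Variables (I : set K -> Type) (V M : forall P : set K, I P -> set (ratfun K)).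
Arguments V : clear implicits.
Arguments M : clear implicits.
Hypothesis V_overring : forall P, nonzero_prime_ideal D P ->
  forall i : I P, valuation_overring D (V P i).
Hypothesis V_extends : forall P, nonzero_prime_ideal D P ->
  forall i : I P, associated_valuation_extends (V P i) (vP P).
Hypothesis M_maximal : forall P, nonzero_prime_ideal D P ->
  forall i : I P, maximal_ideal (V P i) (M P i).
Hypothesis ramification_bounded : forall p, prime_element D0 p ->
  exists2 e : nat, (1 <= e)%N &
    forall P, prime_ideal D P -> P `&` D0 = principal_ideal D0 p ->
    forall i : I P,
      ideal_exp (V P i) (M P i) e `<=` principal_ideal (V P i) (ratC p).
Hypothesis residue_degree_bounded : forall p, prime_element D0 p ->
  exists2 f : nat, (1 <= f)%N &
    forall P, prime_ideal D P -> P `&` D0 = principal_ideal D0 p ->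
    forall i : I P, exists2 n : nat, (n <= f)%N &
      residue_degree (@ratC K @` D0) (@ratC K @` principal_ideal D0 p)
        (V P i) (M P i) n.

Let Dr : subring D. Proof. by case: D_aD. Qed.
Let Dnf : not_a_field D. Proof. by case: D_aD. Qed.
Let D0inf : infinite_set D0. Proof. by have [] := base_PID_euclidean D0_base. Qed.
Let D0_eucl : exists N, euclidean_subring D0 N.
Proof. by have [] := base_PID_euclidean D0_base. Qed.
Let D0r : subring D0. Proof. by case: D0_eucl => N /euclidean_ring. Qed.
Let Max_nzp P : Max D P -> nonzero_prime_ideal D P.
Proof. exact: Max_nonzero_prime. Qed.
Let Max_p P : Max D P -> prime_ideal D P. Proof. by case/Max_nzp. Qed.

Let R : set (ratfun K) := (\bigcap_(P in Max D) \bigcap_(i in [set: I P]) V P i)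
       `&` polys_over [set: K].

Let V_val P (i : I P) : Max D P -> valuation_ring (V P i).
Proof. by move=> /Max_nzp /V_overring /(_ i) []. Qed.

Let V_ratC P (i : I P) c : Max D P -> D c -> V P i (ratC c).
Proof.
move=> /Max_nzp /V_overring /(_ i) [_ sub] Dc; apply: sub.
exact: polys_over_ratC.
Qed.

Let V_unit P (i : I P) c : Max D P -> D c -> ~ P c -> V P i (ratC c)^-1.
Proof.
move=> PM; have Pnz := Max_nzp PM.
exact: (extended_valuation_unit Dr (Max_p PM) (vP_padic Pnz) (V_extends Pnz i)).
Qed.

Let V_nonunit P (i : I P) c : Max D P -> c != 0 -> P c -> ~ V P i (ratC c)^-1.
Proof.
move=> PM; have Pnz := Max_nzp PM.
exact: (extended_valuation_nonunit (Max_p PM) (vP_padic Pnz) (V_extends Pnz i)).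
Qed.

Lemma intersection_subring : subring R.
Proof.
have [p1 pB pM] := polys_over_subring (subring_setT K).
split.
- by split=> // P PM i _; apply: subring1 (V_val i PM).1.
- move=> x y [Vx px] [Vy py]; split; last exact: pB.
  by move=> P PM i _; apply: (subringB (V_val i PM).1); [apply: Vx | apply: Vy].
- move=> x y [Vx px] [Vy py]; split; last exact: pM.
  by move=> P PM i _; apply: (subringM (V_val i PM).1); [apply: Vx | apply: Vy].
Qed.
Let Rr := intersection_subring.

Lemma polys_over_sub_intersection : polys_over D `<=` R.
Proof.
move=> x Dx; split; last by case: Dx => f _ ->; exists f.
by move=> P /Max_nzp /V_overring Pnz i _; have [_] := Pnz i; apply.
Qed.

Let R_ratC c : D0 c -> R (ratC c).
Proof. by move=> D0c; apply/polys_over_sub_intersection/polys_over_ratC => //; apply: D0D. Qed.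

Section AtPrime.
Variable p : K.
Hypothesis pp : prime_element D0 p.

Let D0p : D0 p. Proof. by case: pp. Qed.
Let p0 : p != 0. Proof. by case: pp. Qed.
Let rp0 : ratC p != 0. Proof. by rewrite ratC_eq0. Qed.

Definition rings_above : set (set (ratfun K)) :=
  [set W | exists P (i : I P), [/\ Max D P, P p & W = V P i]].

(** By Bezout, an element of [P] in [D0] not divisible by [p] would put 1 into [P]. *)
Lemma Max_above P : Max D P -> P p -> P `&` D0 = principal_ideal D0 p.
Proof.
move=> PM Pp; have [[PD P0 PDD PMul] nP1 _] := PM.
apply/seteqP; split=> [x [Px D0x]|_ [r D0r' <-]]; last first.
  by split; [rewrite mulrC; apply: PMul => //; apply: D0D | apply: subringM].
apply/(principal_idealP p0); apply: contrapT => npx.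
have [N HN] := D0_eucl.
have [u [w [D0u D0w E]]] := prime_element_bezout HN pp D0x npx.
by apply: nP1; rewrite -E; apply: PDD; apply: PMul => //; apply: D0D.
Qed.

(** The classifier of a single prime [P1] above [p] serves for all of them: on [D0] it separates
    classes modulo [pD0], the contraction of every prime above [p]. *)
Lemma rings_above_exponent : exists2 t, (0 < t)%N &
  forall W, rings_above W -> forall x s, W x -> W (x ^+ t / ratC p ^+ s) ->
    W (x ^+ t / ratC p ^+ s.+1) \/ W (((x ^+ t / ratC p ^+ s) ^+ t - 1) / ratC p).
Proof.
have [[P1 [P1M P1p]]|none] := pselect (exists P, Max D P /\ P p); last first.
  by exists 1%N => // W [P [i [PM Pp _]]]; case: none; exists P.
have [q [cls clsP]] := residue_classifier D_aD D_fin P1M.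
have [e e1 He] := ramification_bounded pp.
have [f f1 Hf] := residue_degree_bounded pp.
pose B := (q ^ f)%N.
exists (B`! ^ e.+1 * e`!)%N; first by rewrite muln_gt0 expn_gt0 !fact_gt0.
move=> _ [P [i [PM Pp ->]]] x s.
have PE := Max_above PM Pp.
have Vval := V_val i PM; have Mmax := M_maximal (Max_nzp PM) i.
have Vr := Vval.1.
have MV := maximal_idealE Vval Mmax.
have Mp : M P i (ratC p).
  apply/MV; split; first by apply: V_ratC => //; apply: D0D.
  by right; apply: V_nonunit.
have [n nf deg] := Hf P (Max_p PM) PE i.
(* The scalars in [residue_degree] are constants of [K(X)]; [ratC'] brings them back to [K], where
   [cls] is defined. *)
pose ratC' y := xget 0 [set c : K | ratC c = y].
have ratCK : cancel (@ratC K) ratC'.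
  by move=> c; apply: ratC_inj; apply: (@xgetPex _ 0 [set b | ratC b = ratC c]); exists c.
have cls_inj c c' : (@ratC K @` D0) c -> (@ratC K @` D0) c' ->
    cls (ratC' c) = cls (ratC' c') -> (@ratC K @` principal_ideal D0 p) (c - c').
  move=> [a D0a <-] [a' D0a' <-]; rewrite !ratCK => /clsP H.
  exists (a - a'); last by rewrite ratCB.
  rewrite -(Max_above P1M P1p); split; last exact: subringB.
  by apply: H; apply: D0D.
have sub : @ratC K @` principal_ideal D0 p `<=` M P i.
  move=> _ [_ [r D0r' <-] <-]; rewrite ratCM mulrC.
  have [[_ _ _ MMul] _ _] := Mmax; apply: MMul => //.
  by apply: V_ratC => //; apply: D0D.
apply: (@uniform_exponent _ _ Vval _ Mmax _ e rp0 Mp (He P (Max_p PM) PE i) B) => //.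
  exact: (residue_unit_exponent Vval Mmax cls_inj sub nf deg).
exact: (residue_field_fact Vval Mmax cls_inj sub nf deg).
Qed.

(** Take a denominator [d] of the coefficients in [D0] and drop its [p]-part: above [p], [w] is
    already integral, and in the other rings [p] is a unit. *)
Lemma local_denominator w : polys_over [set: K] w ->
  (forall W, rings_above W -> W w) ->
  exists2 d, D0 d & ~ D0 (d / p) /\ R (ratC d * w).
Proof.
move=> [f _ wE] Hw.
have [d D0d [d0 dP]] := base_common_denominator D_aD D0r D0D D0inf D_fin D_quot f.
have [N HN] := D0_eucl.
have [c [d' [D0d' nd' d'0 dE]]] := prime_factor_out HN pp D0d d0.
exists d' => //; split=> //.
have Rdw : R (ratC d * w).
  apply: polys_over_sub_intersection; exists (d *: f); last first.
    by rewrite wE -mul_polyC tofracM.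
  move=> j; rewrite coefZ; have [jf|jf] := ltnP j (size f); first exact/dP/mem_nth.
  by rewrite nth_default // mulr0; apply: subring0.
have [pT1 pTB pTM] := polys_over_subring (subring_setT K).
split; last first.
  by apply: pTM; [exact: polys_over_ratC (subring_setT K) _ | exists f].
move=> P PM i _; have Vr := (V_val i PM).1.
have [Pp|nPp] := pselect (P p).
  apply: subringM => //; first by apply: V_ratC => //; apply: D0D.
  by apply: Hw; exists P, i.
have -> : ratC d' * w = (ratC p)^-1 ^+ c * (ratC d * w).
  by rewrite dE ratCM ratCX; apply: mul_expVKf.
apply: subringM => //; first by apply: subringX => //; apply: V_unit => //; apply: D0D.
by case: Rdw => + _; apply.
Qed.

Lemma prime_notdvdM a b : D0 a -> D0 b -> ~ D0 (a / p) -> ~ D0 (b / p) -> ~ D0 (a * b / p).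
Proof.
move=> D0a D0b na nb; have [_ _ _ H] := pp.
by move/(principal_idealP p0)/H => /(_ D0a D0b) [] /(principal_idealP p0).
Qed.

Lemma local_common_denominator (s : seq (ratfun K)) :
  (forall w, w \in s -> polys_over [set: K] w /\ forall W, rings_above W -> W w) ->
  exists2 d, D0 d & ~ D0 (d / p) /\ forall w, w \in s -> R (ratC d * w).
Proof.
elim: s => [_|w s IHs Hs].
  exists 1; first exact: subring1.
  by split=> //; rewrite mul1r; case: pp.
have [|d D0d [nd dP]] := IHs; first by move=> v vs; apply: Hs; rewrite inE vs orbT.
have [pw Ww] := Hs w (mem_head _ _).
have [d' D0d' [nd' d'P]] := local_denominator pw Ww.
exists (d * d'); first exact: subringM.
split=> [|v]; first exact: prime_notdvdM.
rewrite ratCM inE => /orP [/eqP ->|/dP Rv].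
  by rewrite -mulrA; apply: subringM => //; apply: R_ratC.
by rewrite mulrAC; apply: subringM => //; apply: R_ratC.
Qed.

(** The fixed [d] bounds the values of the generators above [p], so [local_inverse] gives
    [\sum_j z j * g j = 1 - u] with [p] dividing [u] there. For a common denominator [b] prime to
    [p], [b * (1 - u)] is in the span and [b * (u / p)] in [R]; [a * b + a' * p = 1] then writes
    [d1] through [b * (1 - u)] and [p * d1]. *)
Lemma inverse_span_prime_cancel n (g U : 'I_n -> ratfun K) d d1 :
  (forall j, R (g j)) -> (forall j, R (U j)) -> D0 d -> d != 0 ->
  \sum_j U j * g j = ratC d -> D0 d1 ->
  inverse_span R g (ratC (p * d1)) -> inverse_span R g (ratC d1).
Proof.
move=> Rg RU D0d d0 sumU D0d1 Tpd1.
have [t t0 Ht] := rings_above_exponent.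
have [N HN] := D0_eucl.
have [c [d' [D0d' nd' d'0 dE]]] := prime_factor_out HN pp D0d d0.
pose A := polys_over [set: K].
have Ar : subring A by apply/polys_over_subring/subring_setT.
have RA x : R x -> A x by case.
have RW W x : rings_above W -> R x -> W x by move=> [P [i [PM _ ->]]] [+ _]; apply.
have ApV : A (ratC p)^-1 by rewrite -ratCV; apply: polys_over_ratC => //; apply: subring_setT.
have [|||||z [u [Au Az sumz Wz Wu]]] :=
    @local_inverse _ A rings_above (ratC p) t n g Ar ApV rp0 t0 _ _ Ht _ _ (c.+1 * t).
- by move=> _ [P [i [PM _ ->]]]; apply: V_val.
- by move=> W HW; apply: RW => //; apply: R_ratC.
- by move=> j; apply: RA.
- by move=> W HW j; apply: RW.
(* If [p ^ (c.+1 * t)] divided every [g j ^ t], then [p ^ c.+1] would divide every [g j], hence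
   [d = p ^ c * d']; as [d'] is a unit in [V P i], so would be [p]. *)
- move=> _ [P [i [PM Pp ->]]]; apply: contrapT => H.
  have Vr := (V_val i PM).1; apply: (V_nonunit (i := i) PM p0 Pp).
  have Vgp j : V P i (g j / ratC p ^+ c.+1).
    apply: (valuation_ring_root (V_val i PM) t0).
    rewrite exprMn exprVn -exprM; apply: contrapT => nV; apply: H.
    by exists j.
  have nPd' : ~ P d'.
    move=> Pd'; apply: nd'; apply/(principal_idealP p0).
    by rewrite -(Max_above PM Pp).
  have -> : (ratC p)^-1 = (\sum_j U j * (g j / ratC p ^+ c.+1)) * (ratC d')^-1.
    under eq_bigr => j _ do rewrite mulrA.
    by rewrite -mulr_suml sumU dE ratCM ratCX; apply: invf_expSK; rewrite ?ratC_eq0.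
  apply: subringM => //; last by apply: V_unit => //; apply: D0D.
  apply: (subring_sum Vr) => j; apply: (subringM Vr) => //.
  by apply: (RW _ _ _ (RU j)); exists P, i.
(* All elements that have to become members of [R] after multiplication by one denominator. *)
pose s := u / ratC p :: [seq z ij.2 * g ij.1 | ij : 'I_n * 'I_n].
have [|b D0b [nb bP]] := @local_common_denominator s.
  move=> w; rewrite inE => /orP [/eqP ->|/mapP [[i j] _ ->]] /=.
    by split=> //; apply: (subringM Ar).
  split; first by apply: (subringM Ar) => //; apply: RA.
  by move=> W HW; apply: Wz.
have [a [a' [D0a D0a' aE]]] := prime_element_bezout HN pp D0b nb.
have Rbeta : R (ratC b * (u / ratC p)) by apply: bP; rewrite mem_head.
have Tb : inverse_span R g (ratC b * (1 - u)).
  exists (fun j => ratC b * z j).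
    move=> i j; rewrite -mulrA; apply: bP; rewrite inE; apply/orP; right.
    by apply/mapP; exists (i, j); rewrite ?mem_enum.
  by rewrite -sumz mulr_sumr; apply: eq_bigr => j _; rewrite mulrA.
have -> : ratC d1 = ratC d1 * ratC a * (ratC b * (1 - u)) +
    (ratC a * (ratC b * (u / ratC p)) + ratC a') * ratC (p * d1).
  by rewrite ratCM; apply: bezout_combination; rewrite -?ratCM -?ratCD ?aE ?ratC1.
apply: inverse_spanD => //; apply: inverse_spanM => //.
  by apply: subringM => //; apply: R_ratC.
by apply: subringD => //; [apply: subringM => //|]; apply: R_ratC.
Qed.

End AtPrime.

Lemma inverse_span_one n (g U : 'I_n -> ratfun K) d :
  (forall j, R (g j)) -> (forall j, R (U j)) -> D0 d -> d != 0 ->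
  \sum_j U j * g j = ratC d -> inverse_span R g 1.
Proof.
move=> Rg RU D0d d0 sumU; have [N HN] := D0_eucl.
have [||u D0u [D0ui [u0 Tu]]] :=
    @prime_cancel_unit _ _ _ HN (fun x => inverse_span R g (ratC x)) _ d D0d d0.
- move=> p d1 pp D0d1 _.
  exact: (inverse_span_prime_cancel pp Rg RU D0d d0 sumU D0d1).
- by exists U => // i j; apply: subringM.
have -> : 1 = ratC u^-1 * ratC u by rewrite -ratCM mulVf // ratC1.
by apply: inverse_spanM => //; apply: R_ratC.
Qed.

(** Dividing the generators by their gcd [H] in [K[X]] and multiplying by [d] only rescales the
    ideal, so invertibility is unaffected. For [d] clearing all coefficients, [d * G' j] and
    [d * U j] lie in [D[X]], and the Bezout relation becomes one with right-hand side [d * d] in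
    [D0]. *)
Lemma intersection_Pruefer : Pruefer_domain R.
Proof.
split=> // J [n [g [Rg ->]]] Jn0.
have gn0 : exists j, g j != 0.
  apply: contrapT => H; apply: Jn0.
  have g0 j : g j = 0 by apply/eqP/negPn/negP => gj; apply: H; exists j.
  apply/seteqP; split=> [_ [c Rc ->]|_ ->].
    by rewrite big1 // => j _; rewrite g0 mulr0.
  exists (fun _ => 0); first by move=> _; apply: subring0.
  by rewrite big1 // => j _; rewrite mul0r.
apply: inverse_span_invertible => //.
have /choice [G gE] j : exists f, g j = tofrac f by have [_ [f _ ->]] := Rg j; exists f.
have [j0 gj0] := gn0.
have [|H [G' [U [H0 GE sumU]]]] := @poly_family_bezout K n G j0.
  by rewrite -tofrac_eq0 -gE.
pose s := flatten [seq (U j : seq K) ++ (G' j : seq K) | j <- enum 'I_n].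
have [d D0d [d0 dP]] := base_common_denominator D_aD D0r D0D D0inf D_fin D_quot s.
have inR (f : {poly K}) : {subset (f : seq K) <= s} -> R (ratC d * tofrac f).
  move=> fs; apply: polys_over_sub_intersection; exists (d *: f); last first.
    by rewrite -mul_polyC tofracM.
  move=> j; rewrite coefZ; have [jf|jf] := ltnP j (size f); first exact/dP/fs/mem_nth.
  by rewrite nth_default // mulr0; apply: subring0.
have sP j c : (c \in (U j : seq K)) || (c \in (G' j : seq K)) -> c \in s.
  move=> Hc; apply/flatten_mapP; exists j; rewrite ?mem_enum // mem_cat //.
have [|||||z Rz z1] := @inverse_span_one n (fun j => ratC d * tofrac (G' j))
   (fun j => ratC d * tofrac (U j)) (d * d).
- by move=> j; apply: inR => c cG; apply: (sP j); rewrite cG orbT.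
- by move=> j; apply: inR => c cU; apply: (sP j); rewrite cU.
- exact: subringM.
- by rewrite mulf_neq0.
- transitivity (ratC d * ratC d * tofrac (\sum_j U j * G' j)).
    rewrite raddf_sum mulr_sumr; apply: eq_bigr => j _ /=.
    by rewrite tofracM; ring.
  by rewrite sumU tofrac1 mulr1 ratCM.
have tH0 : tofrac H != 0 by rewrite tofrac_eq0.
have E i j : z j * ratC d / tofrac H * g i = z j * (ratC d * tofrac (G' i)).
  by rewrite gE GE tofracM; apply: mulfK_middle.
exists (fun j => z j * ratC d / tofrac H); first by move=> i j; rewrite E.
by rewrite z1; apply: eq_bigr => j _; rewrite E.
Qed.

End MainArgument.

Theorem theorem4p9 (K : fieldType) (D D0 : set K)
  (D_almost_Dedekind : almost_Dedekind D)
  (K_quotient_field : quotient_field D = [set: K])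
  (D_finite_residue_fields : finite_residue_fields D)
  (D0_base : base_PID D0) (D0_sub_D : D0 `<=` D)
  (vP : set K -> K -> int)
  (vP_padic : forall P, nonzero_prime_ideal D P -> padic_valuation D P (vP P))
  (I : set K -> Type)
  (V M : forall P : set K, I P -> set (ratfun K))
  (V_overring : forall P, nonzero_prime_ideal D P ->
     forall i : I P, valuation_overring D (V P i))
  (V_extends : forall P, nonzero_prime_ideal D P ->
     forall i : I P, associated_valuation_extends (V P i) (vP P))
  (M_maximal : forall P, nonzero_prime_ideal D P ->
     forall i : I P, maximal_ideal (V P i) (M P i))
  (ramification_bounded : forall p, prime_element D0 p ->
     exists2 e : nat, (1 <= e)%N &
       forall P, prime_ideal D P -> P `&` D0 = principal_ideal D0 p ->
       forall i : I P,
         ideal_exp (V P i) (M P i) e `<=` principal_ideal (V P i) (ratC p))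
  (residue_degree_bounded : forall p, prime_element D0 p ->
     exists2 f : nat, (1 <= f)%N &
       forall P, prime_ideal D P -> P `&` D0 = principal_ideal D0 p ->
       forall i : I P, exists2 n : nat, (n <= f)%N &
         residue_degree (@ratC K @` D0) (@ratC K @` principal_ideal D0 p)
           (V P i) (M P i) n) :
  Pruefer_domain
    ((\bigcap_(P in Max D) \bigcap_(i in [set: I P]) V P i)
       `&` polys_over [set: K]).
Proof.
exact: (@intersection_Pruefer K D D0 _ _ _ D0_base _ vP vP_padic I V M).
Qed.
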